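(* Fix an integer $p\ge 3$ and suppose $(\beta,h)\in\Theta=[0,\infty)\times\mathbb{R}$ is $p$-regular. Assume $\beta$ is known and $\boldsymbol\sigma\sim\mathbb{P}_{\beta,h,p}$. Let $m_*=m_*(\beta,h,p)$ be the unique global maximizer of $H=H_{\beta,h,p}$, and let $\hat h_N$ be the maximum likelihood estimate of $h$ based on $\boldsymbol\sigma$. Then, as $N\to\infty$, $$N^{1/2}(\hat h_N-h)\xrightarrow{D}N\left(0,-H''(m_* )\right).$$
   Context: The $p$-spin Curie-Weiss model is the probability measure on $\{-1,1\}^N$ given by $\mathbb{P}_{\beta,h,p}(\boldsymbol\sigma)=\frac{1}{2^NZ_N(\beta,h,p)}\exp\{N(\beta\overline\sigma_N^p+h\overline\sigma_N)\}$, where $\overline\sigma_N=\frac1N\sum_{i=1}^N\sigma_i$ and $Z_N$ is the normalizing constant; expectation is $\mathbb{E}_{\beta,h,p}$. For fixed known $\beta$, the maximum likelihood estimate $\hat h_N\in[-\infty,\infty]$ is the solution in $h$ of $\mathbb{E}_{\beta,h,p}(\overline\sigma_N)=\overline\sigma_N$ (with value $\pm\infty$ when $\overline\sigma_N=\pm1$). Define $H_{\beta,h,p}:[-1,1]\to\mathbb{R}$ by $H_{\beta,h,p}(x)=\beta x^p+hx-I(x)$, $I(x)=\frac12\{(1+x)\log(1+x)+(1-x)\log(1-x)\}$. The point $(\beta,h)$ is $p$-regular if $H_{\beta,h,p}$ has a unique global maximizer $m_*\in(-1,1)$ and $H_{\beta,h,p}''(m_* )<0$. *)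

(* Defs.v *)
From mathcomp Require Import all_boot all_order all_algebra.
From mathcomp Require Import all_classical all_reals all_analysis.
Set Implicit Arguments.
Unset Strict Implicit.
Unset Printing Implicit Defensive.
Import Order.TTheory GRing.Theory Num.Theory.
Import numFieldNormedType.Exports.
Local Open Scope classical_set_scope.
Local Open Scope ring_scope.

(* Spin configurations; [true] encodes the spin +1 and [false] the spin -1.  *)
Definition config (N : nat) : finType := {ffun 'I_N -> bool}.

Definition spin (R : realType) (b : bool) : R := if b then 1 else -1.

Definition magnetization (R : realType) (N : nat) (s : config N) : R :=
  N%:R^-1 * \sum_(i < N) spin R (s i).

Definition cw_weight (R : realType) (beta h : R) (p N : nat) (s : config N)
    : R :=
  expR (N%:R * (beta * magnetization R s ^+ p + h * magnetization R s)).

Definition cw_partition (R : realType) (beta h : R) (p N : nat) : R :=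
  (2 ^+ N)^-1 * \sum_(s : config N) cw_weight beta h p s.

Definition cw_mass (R : realType) (beta h : R) (p N : nat) (s : config N) : R :=
  (2 ^+ N * cw_partition beta h p N)^-1 * cw_weight beta h p s.

Definition cw_expectation (R : realType) (beta h : R) (p N : nat)
    (f : config N -> R) : R :=
  \sum_(s : config N) cw_mass beta h p s * f s.

(* For 0 < N and a magnetization other than 1 and -1 the equation has exactly
   one real solution, so the default value 0 of [xget] is never used.        *)
Definition mle_h (R : realType) (beta : R) (p N : nat) (s : config N)
    : \bar R :=
  if magnetization R s == 1 then +oo%E
  else if magnetization R s == -1 then -oo%E
  else (xget 0 [set h : R |
          cw_expectation beta h p (@magnetization R N) = magnetization R s])%:E.

(* [ln 0 = 0] in the library, so that 0 log 0 = 0 at the two endpoints.      *)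
Definition entropy (R : realType) (x : R) : R :=
  2^-1 * ((1 + x) * ln (1 + x) + (1 - x) * ln (1 - x)).

(* Meaningful on [-1, 1] only; it is extended to a total function in order to
   apply the library's derivatives, which are only taken inside ]-1, 1[.     *)
Definition Hfun (R : realType) (beta h : R) (p : nat) (x : R) : R :=
  beta * x ^+ p + h * x - entropy x.

Definition global_maximizer (R : realType) (beta h : R) (p : nat) (m : R)
    : Prop :=
  m \in `[-1, 1] /\
  forall x : R, x \in `[-1, 1] -> Hfun beta h p x <= Hfun beta h p m.

Definition p_regular (R : realType) (beta h : R) (p : nat) : Prop :=
  exists m : R,
    [/\ unique (global_maximizer beta h p) m,
        m \in `]-1, 1[
      & (Hfun beta h p)^`(2)%classic m < 0].

(* Convergence in distribution, to a law [mu] on the real line, of extended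
   real random variables [X N] defined on finite probability spaces with mass
   functions [P N]: pointwise convergence of the distribution functions at the
   continuity points of the limit.  As [mu] puts no mass at infinity, this is
   weak convergence on the extended real line.                               *)
Definition cvg_in_distribution (R : realType) (T : nat -> finType)
    (P : forall N : nat, T N -> R) (X : forall N : nat, T N -> \bar R)
    (mu : probability (measurableTypeR R) R) : Prop :=
  forall t : R,
    {for t, continuous (fun x : R => fine (mu `]-oo, x]%classic))} ->
    (\sum_(w : T N | (X N w <= t%:E)%E) P N w) @[N --> \oo]
      --> fine (mu `]-oo, t]%classic).

(* Main.v *)
Require Import Defs.
From mathcomp Require Import all_boot all_order all_algebra.
From mathcomp Require Import all_classical all_reals all_analysis.
From mathcomp Require Import measurable_realfun ring lra.
Import Order.TTheory GRing.Theory Num.Theory.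
Import numFieldNormedType.Exports.
Local Open Scope classical_set_scope.
Local Open Scope ring_scope.

(* The mean of the magnetization is strictly increasing in the field, so
   [sqrt N (mle - h) <= t] says that the magnetization is at most its mean under
   the field [h + t / sqrt N].  Put [a = - H''(m)] and let
   [V = a sqrt N (magnetization - m)] be the rescaled fluctuation: passing to the
   field [h + t / sqrt N] is the exponential tilt by [t V / a], so the event reads
   [V <= c_N], where [c_N] is the mean of [V] under that tilt.
   By the Laplace method, [V] is asymptotically N(0, a) under the field [h]: up to
   factors independent of the value [x] of the magnetization, Stirling's formula
   turns the law of [V] into a Riemann sum of [exp (N (H x - H m))], and the
   normalisation cancels the unknown Stirling constant.  The bound
   [H x - H m <= - c (x - m)^2] makes dominated convergence applicable, also to
   exponentials, so the Laplace transform of [V] tends to [exp (a s^2 / 2)].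
   Convexity of the exponential squeezes [c_N] between difference quotients of
   the Laplace transform at [t / a], which gives [c_N --> t], and the event has
   limit probability N(0, a) (]-oo, t]). *)

(** * Stirling's formula up to a constant *)

Section Stirling.
Context {R : realType}.
Implicit Types (x y s : R) (n k : nat).

Lemma ge0_derive_le (f df : R -> R) x : 0 <= x ->
  (forall y, is_derive y 1 f (df y)) -> (forall y, 0 <= y -> 0 <= df y) ->
  f 0 <= f x.
Proof.
move=> x0 fdf df0.
have fc : {within `[0, x], continuous f}.
  apply: continuous_subspaceT => y.
  by apply/differentiable_continuous/derivable1_diffP; case: (fdf y).
have [c + e] := MVT_segment x0 (fun y _ => fdf y) fc.
rewrite in_itv/= => /andP[c0 _].
by rewrite -subr_ge0 e subr0 mulr_ge0 // df0.
Qed.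

Lemma sinh_ge s : 0 <= s -> s <= (expR s - expR (- s)) / 2.
Proof.
move=> s0.
suff : (expR 0 - expR (- 0)) / 2 - 0 <= (expR s - expR (- s)) / 2 - s.
  by rewrite oppr0; lra.
apply: (@ge0_derive_le (fun s => (expR s - expR (- s)) / 2 - s)
  (fun s => (expR s + expR (- s)) / 2 - 1)) => //.
  move=> y; apply: is_derive_eq.
  by rewrite !scaler0 add0r /GRing.scale /=; lra.
move=> y y0; rewrite expRN.
have e0 := expR_gt0 y.
(* The derivative [cosh y - 1] is half of this quotient. *)
have : 0 <= (expR y - 1)^+2 / expR y by rewrite divr_ge0 ?sqr_ge0 // ltW.
have -> : (expR y - 1) ^+ 2 / expR y = expR y + (expR y)^-1 - 2.
  by field; rewrite gt_eqF.
lra.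
Qed.

Lemma expR_half_ge s : 0 <= s -> 0 <= (s - 2) * expR s + s + 2.
Proof.
move=> s0.
suff : (0 - 2) * expR 0 + 0 + 2 <= (s - 2) * expR s + s + 2.
  by rewrite expR0; lra.
apply: (@ge0_derive_le (fun s => (s - 2) * expR s + s + 2)
  (fun s => (s - 1) * expR s + 1)) => //.
  move=> y; apply: is_derive_eq.
  by rewrite /GRing.scale /=; lra.
move=> y y0.
have := expR_ge1Dx (- y); rewrite expRN => h.
have e0 := expR_gt0 y.
have : (1 - y) * expR y <= 1 by rewrite -ler_pdivlMr // div1r.
lra.
Qed.

(** This is [sinh_ge] at [s = ln y]. Together with [ln_ge_frac] it encloses [ln y] between bounds
    that agree to second order at 1, the precision needed in [stirling_rem_diff], where the
    logarithm is multiplied by [n + 1/2]. *)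
Lemma ln_le_half y : 1 <= y -> ln y <= (y - y^-1) / 2.
Proof.
move=> y1; have y0 : 0 < y by lra.
by have := sinh_ge _ (ln_ge0 y1); rewrite expRN lnK.
Qed.

Lemma ln_ge_frac y : 1 <= y -> 2 * (y - 1) / (y + 1) <= ln y.
Proof.
move=> y1; have y0 : 0 < y by lra.
have := expR_half_ge _ (ln_ge0 y1); rewrite lnK // => h.
by rewrite ler_pdivrMr; lra.
Qed.

Definition stirling_rem n : R := ln n`!%:R - (n%:R + 2^-1) * ln n%:R + n%:R.

Lemma stirling_rem_diff n : (0 < n)%N ->
  stirling_rem n - stirling_rem n.+1 =
  (n%:R + 2^-1) * ln (n.+1%:R / n%:R) - 1.
Proof.
move=> n0; have n0' : 0 < n%:R :> R by rewrite ltr0n.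
have n1' : 0 < n.+1%:R :> R by rewrite ltr0n.
have f0 : 0 < n`!%:R :> R by rewrite ltr0n fact_gt0.
rewrite /stirling_rem factS natrM lnM ?posrE // ln_div ?posrE //.
by rewrite -natr1; lra.
Qed.

(** At [y = (n+1)/n] the lower bound of [ln_ge_frac], multiplied by [n + 1/2], is exactly 1. *)
Lemma stirling_rem_decr n : (0 < n)%N -> stirling_rem n.+1 <= stirling_rem n.
Proof.
move=> n0; have n0' : 0 < n%:R :> R by rewrite ltr0n.
rewrite -subr_ge0 stirling_rem_diff // subr_ge0.
have y1 : 1 <= n.+1%:R / n%:R :> R by rewrite ler_pdivlMr // mul1r ler_nat.
apply: le_trans (ler_wpM2l _ (ln_ge_frac _ y1)); last by lra.
rewrite -natr1 le_eqVlt; apply/orP; left; apply/eqP; field.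
by rewrite !gt_eqF //; lra.
Qed.

(** At [y = (n+1)/n] the upper bound of [ln_le_half], multiplied by [n + 1/2], is [1 + 1/(4n(n+1))],
    and the excess over 1 telescopes. *)
Lemma stirling_rem_incr n : (0 < n)%N ->
  stirling_rem n - (4 * n%:R)^-1 <= stirling_rem n.+1 - (4 * n.+1%:R)^-1.
Proof.
move=> n0; have n0' : 0 < n%:R :> R by rewrite ltr0n.
suff : stirling_rem n - stirling_rem n.+1 <= (4 * n%:R)^-1 - (4 * n.+1%:R)^-1.
  by move: (4 * n%:R)^-1 (4 * n.+1%:R)^-1 => u v; lra.
rewrite stirling_rem_diff //.
have y1 : 1 <= n.+1%:R / n%:R :> R by rewrite ler_pdivlMr // mul1r ler_nat.
suff : (n%:R + 2^-1) * ln (n.+1%:R / n%:R) <= 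
    1 + ((4 * n%:R)^-1 - (4 * n.+1%:R)^-1) :> R.
  by move: (4 * n%:R)^-1 (4 * n.+1%:R)^-1 => u v; lra.
apply: le_trans (ler_wpM2l _ (ln_le_half _ y1)) _; first by lra.
rewrite -natr1 le_eqVlt; apply/orP; left; apply/eqP; field.
by rewrite !gt_eqF //; lra.
Qed.

Lemma stirling_rem1 : stirling_rem 1 = 1 :> R.
Proof. by rewrite /stirling_rem (_ : 1`! = 1)%N // ln1 mulr0 subrr add0r. Qed.

Lemma stirling_rem_le1 n : (0 < n)%N -> stirling_rem n <= 1 :> R.
Proof.
elim: n => // -[_ _|n IH _]; first by rewrite stirling_rem1.
exact: le_trans (stirling_rem_decr _ _) (IH _).
Qed.

Lemma stirling_rem_ge n : (0 < n)%N -> 3 / 4 <= stirling_rem n :> R.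
Proof.
move=> n0; suff : 3/4 <= stirling_rem n - (4 * n%:R)^-1 :> R.
  have : 0 <= (4 * n%:R)^-1 :> R by rewrite invr_ge0 mulr_ge0.
  by move: (4 * n%:R)^-1 => u; lra.
elim: n n0 => // -[_ _|n IH _]; first by rewrite stirling_rem1; lra.
exact: le_trans (IH _) (stirling_rem_incr _ _).
Qed.

Lemma stirling_rem_cvg : exists c : R, stirling_rem n @[n --> \oo] --> c.
Proof.
have h : cvgn (fun n => stirling_rem n.+1 : R).
  apply: nonincreasing_is_cvgn.
    by apply/nonincreasing_seqP => n; apply: stirling_rem_decr.
  by exists (3/4) => _ [n _ <-]; apply: stirling_rem_ge.
exists (limn (fun n => stirling_rem n.+1 : R)).
by rewrite -(cvg_shiftS (stirling_rem : nat -> R)).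
Qed.

(* The binomial probability of [k] successes when the success rate is [k / N]. *)
Definition binom_peak N k : R :=
  'C(N, k)%:R * (k%:R / N%:R) ^+ k * ((N - k)%:R / N%:R) ^+ (N - k).

Lemma binom_peak_ge0 N k : 0 <= binom_peak N k.
Proof. by rewrite /binom_peak !mulr_ge0 // exprn_ge0 // divr_ge0. Qed.

(** The peak is one of the nonnegative terms in the binomial expansion of [(q + r)^N] with
    [q + r = 1]. *)
Lemma binom_peak_le1 N k : (k <= N)%N -> (0 < N)%N -> binom_peak N k <= 1.
Proof.
move=> kN N0; have N0' : N%:R != 0 :> R by rewrite pnatr_eq0 -lt0n.
have <- : ((N - k)%:R / N%:R + k%:R / N%:R) ^+ N = 1 :> R.
  by rewrite -mulrDl -natrD subnK // divff // expr1n.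
rewrite exprDn (bigD1 (inord k)) //= inordK ?ltnS //.
rewrite -[leLHS]addr0 lerD //.
  by rewrite /binom_peak mulr_natl mulrnAl mulrC.
apply: sumr_ge0 => i _; rewrite mulrn_wge0 // mulr_ge0 // exprn_ge0 // divr_ge0 //.
Qed.

(** The powers in [binom_peak] cancel the main terms of Stirling's formula for the three factorials,
    so that only the half powers and the remainders survive. The identity is exact and is checked
    after taking logarithms. *)
Lemma binom_peak_stirling N k : (0 < k < N)%N ->
  binom_peak N k =
  expR (stirling_rem N - stirling_rem k - stirling_rem (N - k)) /
  (Num.sqrt N%:R * Num.sqrt (k%:R / N%:R * ((N - k)%:R / N%:R))).
Proof.
move=> /andP[k0 kN].
have N0 : (0 < N)%N by apply: leq_trans kN.
have j0 : (0 < N - k)%N by rewrite subn_gt0.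
have eNk : N%:R = k%:R + (N - k)%:R :> R by rewrite -natrD subnKC // ltnW.
have f0 n : 0 < n`!%:R :> R by rewrite ltr0n fact_gt0.
have n0 n : (0 < n)%N -> 0 < n%:R :> R by rewrite ltr0n.
have binE : 'C(N, k)%:R = N`!%:R / (k`!%:R * (N - k)`!%:R) :> R.
  by rewrite -(bin_fact (ltnW kN)) !natrM mulfK // mulf_neq0 // gt_eqF.
have pos : 0 < binom_peak N k.
  rewrite /binom_peak !mulr_gt0 ?exprn_gt0 ?divr_gt0 ?n0 //.
  by rewrite bin_gt0 ltnW.
have sq x : 0 < x -> Num.sqrt x = expR (2^-1 * ln x).
  by move=> x0; rewrite mulrC expRM lnK // powR12_sqrt // ltW.
have lnX x n : 0 < x -> ln (x ^+ n) = n%:R * ln x.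
  by move=> x0; rewrite lnXn // mulr_natl.
have p0 : 0 < k%:R / N%:R * ((N - k)%:R / N%:R) :> R.
  by rewrite mulr_gt0 ?divr_gt0 ?n0.
rewrite !sq ?n0 // -expRD -expRN -expRD -[LHS]lnK //; congr expR.
rewrite /binom_peak binE.
rewrite !lnM ?posrE ?mulr_gt0 ?divr_gt0 ?invr_gt0 ?exprn_gt0 ?divr_gt0 ?mulr_gt0 ?n0 ?fact_gt0 //.
rewrite !lnX ?divr_gt0 ?n0 // !lnV ?posrE ?mulr_gt0 ?n0 ?fact_gt0 //.
rewrite !ln_div ?posrE ?n0 ?fact_gt0 // !lnM ?posrE ?n0 ?fact_gt0 //.
rewrite /stirling_rem eNk; move: (N - k)%N => j.
by field.
Qed.

End Stirling.

(** * The rate function near and away from its maximizer *)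

Section Taylor.
Context {R : realType}.
Implicit Types (f g : R -> R) (x y e d m b : R).

Lemma MVT_ball f g m d x : `|x - m| < d ->
  (forall y, `|y - m| < d -> is_derive y 1 f (g y)) ->
  exists2 y, `|y - m| <= `|x - m| & f x - f m = g y * (x - m).
Proof.
move=> xd fg.
have cont a b : (forall y, a <= y <= b -> `|y - m| < d) ->
    {within `[a, b], continuous f}.
  move=> ab; apply: derivable_within_continuous => y; rewrite in_itv/= => /ab yd.
  by case: (fg y yd).
have [xm|mx] := leP x m.
  have ab y : x <= y <= m -> `|y - m| < d.
    move=> /andP[xy ym]; apply: le_lt_trans xd.
    by rewrite !ler0_norm ?subr_le0 // lerN2 lerD2r.
  have fg' y : y \in `]x, m[ -> is_derive y 1 f (g y).
    by rewrite in_itv/= => /andP[y1 y2]; apply/fg/ab; rewrite !ltW.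
  have [c + e] := MVT_segment xm fg' (cont _ _ ab).
  rewrite in_itv/= => /andP[xc cm]; exists c.
    by rewrite !ler0_norm ?subr_le0 // lerN2 lerD2r.
  by rewrite -[RHS]opprK -mulrN opprB -e opprB.
have ab y : m <= y <= x -> `|y - m| < d.
  move=> /andP[xy ym]; apply: le_lt_trans xd.
  by rewrite !ger0_norm ?subr_ge0 ?lerD2r // ltW.
have fg' y : y \in `]m, x[ -> is_derive y 1 f (g y).
  by rewrite in_itv/= => /andP[y1 y2]; apply/fg/ab; rewrite !ltW.
have [c + e] := MVT_segment (ltW mx) fg' (cont _ _ ab).
rewrite in_itv/= => /andP[xc cm]; exists c => //.
by rewrite !ger0_norm ?subr_ge0 ?lerD2r // ltW.
Qed.

Lemma is_derive_near_le g m b e : is_derive m 1 g b -> 0 < e ->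
  \forall x \near m, `|g x - g m - b * (x - m)| <= e * `|x - m|.
Proof.
move=> [dg gb] e0.
have : (fun h => h^-1 *: (g (h + m) - g m)) @ 0^' --> b.
  rewrite -gb -derive1E /derive1.
  by move: dg => /derivable1_diffP; rewrite -derivable1_diffP /derivable => dg;
   move: dg; under eq_fun do rewrite /= [_%:A]mulr1.
move=> /cvgrPdist_le /(_ _ e0).
rewrite near_withinE => H.
have : \forall x \near m, x - m != 0 ->
    `|b - (x - m)^-1 *: (g (x - m + m) - g m)| <= e.
  have cm : (fun x => x - m) x @[x --> m] --> (0 : R).
    rewrite -[X in _ --> X](subrr m);  apply: cvgB; [exact: cvg_id | exact: cvg_cst].
  exact: (cm _ H).
apply: filterS => x.
have [->|xm] := eqVneq x m.
  by rewrite !subrr mulr0 subrr !normr0 mulr0.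
rewrite subr_eq0 => /(_ xm); rewrite subrK => h.
have x0 : x - m != 0 by rewrite subr_eq0.
have -> : g x - g m - b * (x - m) =
   - (b - (x - m)^-1 *: (g x - g m)) * (x - m).
  by rewrite /GRing.scale /=; field.
by rewrite normrM normrN ler_wpM2r.
Qed.

(** Subtracting the quadratic from [f] leaves a function with derivative [g y - b (y - m)], which is
    small relative to [y - m]. The mean value theorem then gains one more factor [x - m], because
    the intermediate point is no farther from [m] than [x]. *)
Lemma taylor2 f g m b e :
  (\forall x \near m, is_derive (x : R) 1 f (g x)) -> is_derive m 1 g b -> g m = 0 ->
  0 < e ->
  \forall x \near m, `|f x - f m - b / 2 * (x - m) ^+ 2| <= e * (x - m) ^+ 2.
Proof.
move=> fg gb gm e0.
have := @filterI _ _ (nbhs_filter m) _ _ fg (is_derive_near_le _ _ _ _ gb e0).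
move=> /nbhs_ballP[d /= d0 H].
apply/nbhs_ballP; exists d => //= x; rewrite /ball /= distrC => xd.
have H' y : `|y - m| < d -> is_derive y 1 f (g y) /\
    `|g y - g m - b * (y - m)| <= e * `|y - m|.
  by move=> yd; apply: (H y); rewrite /ball /= distrC.
have [|y ym eq] := @MVT_ball (fun x => f x - b / 2 * (x - m) ^+ 2)
   (fun x => g x - b * (x - m)) m d x xd.
  move=> y yd; have [fy _] := H' y yd.
  apply: is_derive_eq; rewrite /GRing.scale /=; lra.
have -> : f x - f m - b / 2 * (x - m) ^+ 2 = (g y - b * (y - m)) * (x - m).
  by rewrite -eq subrr; lra.
rewrite normrM -real_normK ?num_real // expr2 mulrA ler_wpM2r //.
have [_] := H' y (le_lt_trans ym xd); rewrite gm subr0 => h.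
by apply: le_trans h _; rewrite ler_wpM2l // ltW.
Qed.

End Taylor.

(** * Continuity of the entropy and its values at the lattice points *)

Section Entropy.
Context {R : realType}.
Implicit Types (x y e d : R).

Lemma continuous_xlnx : continuous (fun x : R => x * ln x).
Proof.
move=> x; have [x0|x0|->] := ltgtP x 0.
- rewrite /continuous_at.
  have xn : \forall y \near x, (fun=> 0) y = y * ln y.
    near=> y; rewrite ln0 ?mulr0 //.
    by apply/ltW; near: y; exact: lt_nbhsl.
  rewrite -(nbhs_singleton xn).
  by apply: cvg_trans (near_eq_cvg xn) _; apply: cvg_cst.
- by apply: cvgM; [exact: cvg_id | exact: continuous_ln].
rewrite /continuous_at mul0r.
apply/cvgr0Pnorm_le => e e0.
(* With [r = sqrt y], one has [y ln y = 2 r (r ln r)], and [ln (1/r) < 1/r] gives [r |ln r| < 1] for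
   [y < 1]. Hence [|y ln y| < 2 r], which is below [e] as soon as [y < (e/2)^2]. *)
have e1 : 0 < Num.min 1 ((e / 2) ^+ 2) by rewrite lt_min ltr01 exprn_gt0 // divr_gt0.
near=> y.
have : `|0 - y| < Num.min 1 ((e / 2) ^+ 2).
  by near: y; apply: (@cvgr_dist_lt _ _ _ (nbhs (0 : R)) _ id) => //; exact: cvg_id.
rewrite sub0r normrN lt_min => /andP[y1 ye].
have [y0|y0] := leP y 0; first by rewrite ln0 // mulr0 normr0 ltW.
rewrite gtr0_norm // in y1 ye.
have s0 : 0 < Num.sqrt y by rewrite sqrtr_gt0.
have ey : y = Num.sqrt y ^+ 2 by rewrite sqr_sqrtr // ltW.
have s0' : 0 < (Num.sqrt y)^-1 by rewrite invr_gt0.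
have := ln_sublinear s0'; rewrite lnV // => hl.
have lny : ln y = 2 * ln (Num.sqrt y) by rewrite {1}ey lnXn // mulr_natl.
have l0 : ln y <= 0 by apply: ln_le0; exact: ltW.
rewrite normrM gtr0_norm // ler0_norm //.
have se : Num.sqrt y < e / 2.
  by rewrite -(ger0_norm (ltW s0)) -[e/2]ger0_norm ?divr_ge0 ?ltW // -ltr_sqr
    ?nnegrE // !real_normK ?num_real // -ey.
have : Num.sqrt y * - ln (Num.sqrt y) < 1.
  by rewrite -ltr_pdivlMl // mulr1.
move=> h; rewrite lny [X in X * _]ey.
have : Num.sqrt y * (Num.sqrt y * - ln (Num.sqrt y)) < Num.sqrt y * 1.
  by rewrite ltr_pM2l.
by move: s0 se; rewrite expr2; move: (Num.sqrt y) => r; move: (ln r) => l; lra.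
Unshelve. all: end_near. Qed.

Lemma continuous_entropy : continuous (@entropy R).
Proof.
move=> x; rewrite /entropy; apply: cvgM; first exact: cvg_cst.
apply: cvgD.
  apply: (@continuous_comp _ _ _ (fun x => 1 + x) (fun x => x * ln x)).
    by apply: cvgD; [exact: cvg_cst | exact: cvg_id].
  exact: continuous_xlnx.
apply: (@continuous_comp _ _ _ (fun x => 1 - x) (fun x => x * ln x)).
  by apply: cvgB; [exact: cvg_cst | exact: cvg_id].
exact: continuous_xlnx.
Qed.

(** Multiplied by ['C(N, k)], the right-hand side is [2 ^ N] times [binom_peak]: the entropy is the
    exponential rate of the binomial coefficient. *)
Lemma expR_entropy_mag_value N k : (0 < N)%N -> (k <= N)%N ->
  expR (N%:R * entropy (2 * k%:R / N%:R - 1)) =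
  2 ^+ N * (k%:R / N%:R) ^+ k * ((N - k)%:R / N%:R) ^+ (N - k) :> R.
Proof.
move=> N0 kN; have N0' : 0 < N%:R :> R by rewrite ltr0n.
have xl n j : (0 < j)%N -> expR (n%:R * ln (2 * n%:R / j%:R)) = 2 ^+ n * (n%:R / j%:R) ^+ n :> R.
  (* At an endpoint [n = 0], the product with the logarithm vanishes and [0 ^ 0 = 1]. *)
  move=> j0; have [->|n0] := posnP n; first by rewrite mul0r expR0 !expr0 mulr1.
  rewrite expRM_natl lnK ?posrE ?divr_gt0 ?mulr_gt0 ?ltr0n //.
  by rewrite -mulrA exprMn.
have eNk : N%:R = k%:R + (N - k)%:R :> R by rewrite -natrD subnKC.
rewrite /entropy.
have -> : 1 + (2 * k%:R / N%:R - 1) = 2 * k%:R / N%:R :> R by lra.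
have -> : 1 - (2 * k%:R / N%:R - 1) = 2 * (N - k)%:R / N%:R :> R.
  by rewrite (_ : (N - k)%:R = N%:R - k%:R :> R); [field; rewrite gt_eqF | lra].
have -> : N%:R * (2^-1 *
  (2 * k%:R / N%:R * ln (2 * k%:R / N%:R) +
   2 * (N - k)%:R / N%:R * ln (2 * (N - k)%:R / N%:R))) =
   k%:R * ln (2 * k%:R / N%:R) + (N - k)%:R * ln (2 * (N - k)%:R / N%:R) :> R.
  by move: (ln _) (ln _) => u v; field; rewrite gt_eqF.
rewrite expRD !xl //.
have -> : 2 ^+ N = 2 ^+ k * 2 ^+ (N - k) :> R by rewrite -exprD subnKC.
by ring.
Qed.

End Entropy.

(** * Derivatives of the rate function *)

Section Hfun.
Context {R : realType}.
Variables (beta h : R) (p : nat).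
Implicit Types (x y e d m : R).
Local Notation H := (Hfun beta h p).

Definition dHfun x : R :=
  beta * (p%:R * x ^+ p.-1) + h - 2^-1 * (ln (1 + x) - ln (1 - x)).

Lemma is_derive_exprn n x :
  is_derive x 1 (fun y : R => y ^+ n) (n%:R * x ^+ n.-1).
Proof.
rewrite -[X in is_derive _ _ X _](exprfctE id).
by apply: is_derive_eq; rewrite /GRing.scale /= mulr1.
Qed.

Lemma is_derive_ln_aff (s x : R) : 0 < 1 + s * x ->
  is_derive x 1 (fun y => ln (1 + s * y)) ((1 + s * x)^-1 * s).
Proof.
move=> x0; apply: (@is_derive1_comp _ (@ln R) (fun y => 1 + s * y)).
  exact: is_derive1_ln.
by apply: is_derive_eq; rewrite /GRing.scale /=; lra.
Qed.

Lemma is_derive_entropy x : -1 < x < 1 ->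
  is_derive x 1 (@entropy R) (2^-1 * (ln (1 + x) - ln (1 - x))).
Proof.
move=> /andP[x1 x2].
have p1 : 0 < 1 + 1 * x by lra.
have p2 : 0 < 1 + -1 * x by lra.
have d1 := is_derive_ln_aff _ _ p1; have d2 := is_derive_ln_aff _ _ p2.
have -> : @entropy R = (fun x => 2^-1 * ((1 + x) * ln (1 + 1 * x)
   + (1 - x) * ln (1 + -1 * x))).
  by apply/funext => y; rewrite /entropy mul1r mulN1r.
apply: is_derive_eq; rewrite /GRing.scale /= mul1r mulN1r.
move: (ln _) (ln _) => u v; field.
by rewrite mul1r in p1; rewrite mulN1r in p2; rewrite !gt_eqF.
Qed.

Lemma is_derive_Hfun x : -1 < x < 1 -> is_derive x 1 H (dHfun x).
Proof.
move=> x1; have d1 := is_derive_entropy _ x1.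
have d2 := is_derive_exprn p x.
rewrite /Hfun; apply: is_derive_eq; rewrite /dHfun /GRing.scale /=.
move: (ln _) (ln _) (x ^+ _) => u v w; lra.
Qed.

Lemma derivable_dHfun x : -1 < x < 1 -> derivable dHfun x 1.
Proof.
move=> /andP[x1 x2].
have p1 : 0 < 1 + 1 * x by lra.
have p2 : 0 < 1 + -1 * x by lra.
have d1 := is_derive_ln_aff _ _ p1; have d2 := is_derive_ln_aff _ _ p2.
have d3 := is_derive_exprn p.-1 x.
have -> : dHfun = (fun x => beta * (p%:R * x ^+ p.-1) + h
   - 2^-1 * (ln (1 + 1 * x) - ln (1 + -1 * x))).
  by apply/funext => y; rewrite /dHfun mul1r mulN1r.
by apply: ex_derive.
Qed.

Lemma near_oo m : -1 < m < 1 -> \forall x \near m, -1 < x < 1.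
Proof.
move=> /andP[m1 m2]; near=> x; apply/andP; split; near: x.
  exact: lt_nbhsr.
exact: lt_nbhsl.
Unshelve. all: end_near. Qed.

Lemma is_derive_dHfun m : -1 < m < 1 ->
  is_derive m 1 dHfun (H^`(2)%classic m).
Proof.
move=> m1; apply: DeriveDef; first exact: derivable_dHfun.
rewrite derive1nS derive1E.
apply: near_eq_derive.
apply: filterS (near_oo _ m1) => x x1.
by rewrite derive1n1 derive1E; case: (is_derive_Hfun _ x1) => _ ->.
Qed.

Lemma continuous_Hfun : continuous H.
Proof.
move=> x; rewrite /Hfun; apply: cvgB; last exact: continuous_entropy.
apply: cvgD; apply: cvgM; try exact: cvg_cst; try exact: cvg_id.
exact: exprn_continuous.
Qed.

(** * Quadratic behaviour at a regular maximizer *)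

Section regular.
Variable m : R.
Hypothesis m1 : -1 < m < 1.
Hypothesis mmax : forall x, x \in `[-1, 1] -> x != m -> H x < H m.
Hypothesis H2 : H^`(2)%classic m < 0.

Lemma dHfun_max : dHfun m = 0.
Proof.
have [_ <-] := is_derive_Hfun _ m1.
have : is_derive m 1 H 0; last by case.
apply: (@derive1_at_max R H (-1) 1 m) => //.
- by move=> t; rewrite in_itv/= => /is_derive_Hfun [].
- move=> t; rewrite in_itv/= => /andP[t1 t2].
  have [->//|tm] := eqVneq t m; apply/ltW/mmax => //.
  by rewrite in_itv/= !ltW.
Qed.

Lemma Hfun_taylor e : 0 < e -> \forall x \near m,
  `|H x - H m - H^`(2)%classic m / 2 * (x - m) ^+ 2| <= e * (x - m) ^+ 2.
Proof.
move=> e0; apply: (@taylor2 _ _ dHfun) => //.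
- by apply: filterS (near_oo _ m1) => x; exact: is_derive_Hfun.
- exact: is_derive_dHfun.
- exact: dHfun_max.
Qed.

(** On a segment that avoids [m], compactness gives a positive gap between [H m] and the maximum. As
    [(x - m)^2 <= 4] on [[-1, 1]], a constant gap is also a quadratic one. *)
Lemma Hfun_away d a b : 0 < d -> a <= b -> -1 <= a -> b <= 1 ->
  (forall x, a <= x <= b -> d <= `|x - m|) ->
  exists2 c, 0 < c & forall x, a <= x <= b -> H x - H m <= - c * (x - m) ^+ 2.
Proof.
move=> d0 ab a1 b1 abd.
have [y yab ymax] := EVT_max ab (continuous_subspaceT continuous_Hfun).
have yab' : a <= y <= b by rewrite in_itv/= in yab.
have Hy : H y < H m.
  apply: mmax; first by rewrite in_itv/=; lra.
  by apply/negP => /eqP ym; have := abd _ yab'; rewrite ym subrr normr0; lra.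
exists ((H m - H y) / 4); first by rewrite divr_gt0 // subr_gt0.
move=> x xab; have [ax xb] := andP xab; have [m_1 m_2] := andP m1.
have Hx : H x <= H y by apply: ymax; rewrite in_itv.
have : (x - m) ^+ 2 <= 4.
  have : 0 <= (2 - (x - m)) * (2 + (x - m)) by rewrite mulr_ge0 //; lra.
  lra.
move: (_ ^+ 2) => q q4.
have : (H m - H y) * q <= (H m - H y) * 4 by rewrite ler_wpM2l // subr_ge0 ltW.
lra.
Qed.

Lemma Hfun_quadratic_bound :
  exists2 c, 0 < c & forall x, -1 <= x <= 1 -> H x - H m <= - c * (x - m) ^+ 2.
Proof.
have [m_1 m_2] := andP m1.
(* A Taylor error of this size consumes half of the coefficient [H''(m) / 2] and leaves
   [H''(m) / 4], which is still negative. *)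
have e0 : 0 < - H^`(2)%classic m / 4 by rewrite divr_gt0 // oppr_gt0.
have := Hfun_taylor _ e0; move=> /nbhs_ballP[d /= d0 near_m].
(* The radius lies strictly below [d], and it is small enough for the two outer segments
   [[-1, m - d']] and [[m + d', 1]] to be nonempty. *)
pose d' := Num.min (d / 2) (Num.min ((1 - m) / 2) ((m + 1) / 2)).
have [d'0 d'd d'1 d'2] : [/\ 0 < d', d' < d, d' < 1 - m & d' < m + 1].
  rewrite /d' !lt_min !gt_min; split.
  - by apply/and3P; split; lra.
  - by apply/orP; left; lra.
  - by apply/orP; right; apply/orP; left; lra.
  - by apply/orP; right; apply/orP; right; lra.
have [||||c1 c10 Hc1] := @Hfun_away d' (-1) (m - d') d'0; try lra.
  by move=> x xm; rewrite ler0_norm; lra.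
have [||||c2 c20 Hc2] := @Hfun_away d' (m + d') 1 d'0; try lra.
  by move=> x xm; rewrite ger0_norm; lra.
pose c3 := - H^`(2)%classic m / 4.
exists (Num.min c3 (Num.min c1 c2)); first by rewrite !lt_min e0 c10 c20.
move=> x x1.
have le c : Num.min c3 (Num.min c1 c2) <= c -> H x - H m <= - c * (x - m) ^+ 2 ->
  H x - H m <= - Num.min c3 (Num.min c1 c2) * (x - m) ^+ 2.
  move=> cc /le_trans; apply.
  by rewrite ler_wpM2r ?sqr_ge0 // lerN2.
have [xd|xd] := leP x (m - d').
  apply: (le c1); last by apply: Hc1; lra.
  by rewrite !ge_min lexx !orbT.
have [xd'|xd'] := leP (m + d') x.
  apply: (le c2); last by apply: Hc2; lra.
  by rewrite !ge_min lexx !orbT.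
apply: (le c3); first by rewrite !ge_min lexx.
have := near_m x; rewrite /ball /= distrC => /(_ _).
have -> : `|x - m| < d by rewrite ltr_norml; apply/andP; split; lra.
move=> /(_ isT); rewrite ler_norml => /andP[_].
by rewrite /c3 /derive1n /=; move: (derive1 _ m) ((x - m) ^+ 2) => B q; lra.
Qed.

End regular.
End Hfun.

(** * Monotonicity of the likelihood equation *)

Section MLE.
Context {R : realType}.
Variables (beta : R) (p N : nat).
Hypothesis N0 : (0 < N)%N.
Implicit Types (x y h t : R) (s : config N).

Local Notation mag := (@magnetization R N).

Let N0' : 0 < N%:R :> R. Proof. by rewrite ltr0n. Qed.

Lemma magnetization_cst (b : bool) : mag [ffun=> b] = spin R b.
Proof.
rewrite /magnetization (eq_bigr (fun=> spin R b)); last by move=> i _; rewrite ffunE.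
by rewrite sumr_const card_ord -[X in _ * X]mulr_natl mulrA mulVf ?mul1r // gt_eqF.
Qed.

Lemma magnetization_itv s : -1 <= mag s <= 1.
Proof.
rewrite /magnetization ler_pdivlMl // ler_pdivrMl // mulr1 mulrN1.
have e (z : R) : \sum_(i < N) z = N%:R * z.
  by rewrite sumr_const card_ord mulr_natl.
apply/andP; split.
  rewrite -mulrN1 -e; apply: ler_sum => i _; rewrite /spin; case: (s i); lra.
rewrite -[leRHS]mulr1 -e; apply: ler_sum => i _; rewrite /spin; case: (s i); lra.
Qed.

Lemma cw_weight_gt0 h s : 0 < cw_weight beta h p s.
Proof. exact: expR_gt0. Qed.

Lemma sum_cw_weight_gt0 h : 0 < \sum_(s : config N) cw_weight beta h p s.
Proof.
rewrite (bigD1 [ffun=> true]) //= ltr_wpDr ?cw_weight_gt0 //.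
by apply: sumr_ge0 => s _; exact/ltW/cw_weight_gt0.
Qed.

Lemma cw_massE h s : cw_mass beta h p s =
  cw_weight beta h p s / \sum_(s : config N) cw_weight beta h p s.
Proof.
have two : (2 ^+ N : R) != 0 by rewrite gt_eqF // exprn_gt0.
by rewrite /cw_mass /cw_partition (mulVKf two) [LHS]mulrC.
Qed.

Lemma cw_expectationE h (f : config N -> R) : cw_expectation beta h p f =
  (\sum_(s : config N) cw_weight beta h p s * f s) /
  \sum_(s : config N) cw_weight beta h p s.
Proof.
rewrite /cw_expectation mulr_suml; apply: eq_bigr => s _.
by rewrite cw_massE mulrAC.
Qed.

(* Up to the positive factor [exp (- N h x)], the unnormalised expectation of
   the magnetization minus [x]; unlike the expectation itself it is visibly
   increasing in [h]. *)
Definition score x h : R := \sum_(s : config N) cw_weight beta 0 p s *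
  ((mag s - x) * expR (N%:R * h * (mag s - x))).

Lemma scoreE x h : (\sum_(s : config N) cw_weight beta h p s) *
  (cw_expectation beta h p mag - x) = expR (N%:R * h * x) * score x h.
Proof.
have S0 := sum_cw_weight_gt0 h.
rewrite cw_expectationE mulrBr mulrC divfK ?gt_eqF // mulr_suml -sumrB mulr_sumr.
apply: eq_bigr => s _; rewrite -mulrBr /cw_weight.
have -> : expR (N%:R * (beta * mag s ^+ p + h * mag s)) =
  expR (N%:R * (beta * mag s ^+ p + 0 * mag s)) * expR (N%:R * h * (mag s - x)) *
  expR (N%:R * h * x) by rewrite -!expRD; congr expR; ring.
ring.
Qed.

Lemma cw_expectation_ge x h : (x <= cw_expectation beta h p mag) = (0 <= score x h).
Proof.
rewrite -subr_ge0 -(pmulr_rge0 _ (sum_cw_weight_gt0 h)) scoreE.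
by rewrite pmulr_rge0 // expR_gt0.
Qed.

Lemma cw_expectation_eq x h : cw_expectation beta h p mag = x <-> score x h = 0.
Proof.
have S0 := sum_cw_weight_gt0 h; have E := scoreE x h.
have E0 := expR_gt0 (N%:R * h * x).
split=> e; move: E; rewrite e ?subrr ?mulr0.
  by move=> /esym/eqP; rewrite mulf_eq0 (gt_eqF E0) /= => /eqP.
by move=> /eqP; rewrite mulf_eq0 (gt_eqF S0) /= subr_eq0 => /eqP.
Qed.

(** The factor [y] compensates the direction in which the exponential moves, so each term of [score]
    is monotone in the field whatever the sign of [y]. *)
Lemma expR_tilt_le y h t : h <= t ->
  y * expR (N%:R * h * y) <= y * expR (N%:R * t * y).
Proof.
move=> ht; have [y0|y0] := leP 0 y.
  by rewrite ler_wpM2l // ler_expR ler_wpM2r // ler_wpM2l // ltW.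
by rewrite ler_nM2l // ler_expR ler_wnM2r ?ler_wpM2l // ltW.
Qed.

(** All terms are nondecreasing in the field, and the all-plus configuration, whose magnetization 1
    exceeds [x], makes the increase strict. *)
Lemma score_lt x h t : x < 1 -> h < t -> score x h < score x t.
Proof.
move=> x1 ht; rewrite /score (bigD1 [ffun=> true]) //= [ltRHS](bigD1 [ffun=> true]) //=.
apply: ltr_leD.
  rewrite ltr_pM2l ?cw_weight_gt0 // magnetization_cst /=.
  have y0 : 0 < 1 - x by lra.
  by rewrite ltr_pM2l // ltr_expR ltr_pM2r // ltr_pM2l.
apply: ler_sum => s _; rewrite ler_wpM2l ?(ltW (cw_weight_gt0 _ _)) //.
exact/expR_tilt_le/ltW.
Qed.

Lemma score_le x h t : h <= t -> score x h <= score x t.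
Proof.
move=> ht; apply: ler_sum => s _; rewrite ler_wpM2l ?(ltW (cw_weight_gt0 _ _)) //.
exact/expR_tilt_le.
Qed.

Lemma continuous_score x : continuous (score x).
Proof.
apply: (@continuous_big R^o (config N) _ 0 xpredT (@add_continuous R^o) R
  (index_enum (config N))
  (fun s h => cw_weight beta 0 p s * ((mag s - x) * expR (N%:R * h * (mag s - x))))).
move=> s _ h; apply: cvgM; first exact: cvg_cst.
apply: cvgM; first exact: cvg_cst.
apply: (cvg_comp (fun h => N%:R * h * (mag s - x)) expR); last exact: continuous_expR.
apply: cvgM; last exact: cvg_cst.
by apply: cvgM; [exact: cvg_cst | exact: cvg_id].
Qed.

(** For nonnegative fields the all-plus term grows at least linearly, by [1 + u <= exp u], while the
    other terms stay above their values at field 0, whose sum is [K]. *)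
Lemma score_ge0_ex x : x < 1 -> exists2 h, 0 <= h & 0 <= score x h.
Proof.
move=> x1; pose A := cw_weight beta 0 p ([ffun=> true] : config N).
have A0 : 0 < A by exact: cw_weight_gt0.
have y0 : 0 < 1 - x by lra.
pose K := \sum_(s : config N | s != [ffun=> true]) cw_weight beta 0 p s * (mag s - x).
have D0 : 0 < A * N%:R * (1 - x) ^+ 2 by rewrite !mulr_gt0 // exprn_gt0.
(* At this field the linear gain [A N h (1 - x)^2] is exactly [|K|]. *)
exists (`|K| / (A * N%:R * (1 - x) ^+ 2)); first by rewrite divr_ge0 // ltW.
set h := _ / _; have h0 : 0 <= h by rewrite divr_ge0 // ltW.
rewrite /score (bigD1 [ffun=> true]) //= -/A magnetization_cst /=.
have : A * ((1 - x) * (1 + N%:R * h * (1 - x))) + K <= A * ((1 - x) * expR (N%:R * h * (1 - x))) +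
   \sum_(s : config N | s != [ffun=> true]) cw_weight beta 0 p s *
     ((mag s - x) * expR (N%:R * h * (mag s - x))).
  apply: lerD; first by rewrite ler_pM2l // ler_pM2l // expR_ge1Dx.
  apply: ler_sum => s _; rewrite ler_pM2l ?cw_weight_gt0 //.
  apply: le_trans (expR_tilt_le _ 0 h h0).
  by rewrite mulr0 mul0r expR0 mulr1.
apply: le_trans.
have -> : A * ((1 - x) * (1 + N%:R * h * (1 - x))) = A * (1 - x) + `|K|.
  by rewrite /h; field; rewrite !gt_eqF.
have : 0 < A * (1 - x) by rewrite mulr_gt0.
have := ler_norm (- K); rewrite normrN; lra.
Qed.

(** The mirror image of [score_ge0_ex], with the all-minus configuration and a nonpositive field. *)
Lemma score_le0_ex x : -1 < x -> exists2 h, h <= 0 & score x h <= 0.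
Proof.
move=> x1; pose A := cw_weight beta 0 p ([ffun=> false] : config N).
have A0 : 0 < A by exact: cw_weight_gt0.
have y0 : -1 - x < 0 by lra.
have y0' : 0 < 1 + x by lra.
pose K := \sum_(s : config N | s != [ffun=> false]) cw_weight beta 0 p s * (mag s - x).
have D0 : 0 < A * N%:R * (1 + x) ^+ 2 by rewrite !mulr_gt0 // exprn_gt0.
exists (- (`|K| / (A * N%:R * (1 + x) ^+ 2))); first by rewrite oppr_le0 divr_ge0 // ltW.
set h := - (_ / _); have h0 : h <= 0 by rewrite oppr_le0 divr_ge0 // ltW.
rewrite /score (bigD1 [ffun=> false]) //= -/A magnetization_cst /=.
have : A * ((-1 - x) * expR (N%:R * h * (-1 - x))) +
   \sum_(s : config N | s != [ffun=> false]) cw_weight beta 0 p s *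
     ((mag s - x) * expR (N%:R * h * (mag s - x)))
   <= A * ((-1 - x) * (1 + N%:R * h * (-1 - x))) + K.
  apply: lerD; first by rewrite ler_pM2l // ler_nM2l // expR_ge1Dx.
  apply: ler_sum => s _; rewrite ler_pM2l ?cw_weight_gt0 //.
  apply: le_trans (expR_tilt_le _ h 0 h0) _.
  by rewrite mulr0 mul0r expR0 mulr1.
move=> /le_trans; apply.
have -> : A * ((-1 - x) * (1 + N%:R * h * (-1 - x))) = - (A * (1 + x)) - `|K|.
  by rewrite /h; field; rewrite !gt_eqF.
have : 0 < A * (1 + x) by rewrite mulr_gt0.
have := ler_norm K; lra.
Qed.

Lemma score_root x : -1 < x < 1 -> exists h, score x h = 0.
Proof.
move=> /andP[x1 x2].
have [a a0 sa] := score_le0_ex _ x1; have [b b0 sb] := score_ge0_ex _ x2.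
have v : Num.min (score x a) (score x b) <= 0 <= Num.max (score x a) (score x b).
  by rewrite ge_min sa le_max sb orbT.
have [c _ ?] := IVT (le_trans a0 b0)
  (continuous_subspaceT (continuous_score x)) v.
by exists c.
Qed.

(** No term is positive and the all-minus term is negative. Strictness matters: at magnetization 1
    the estimate is [+oo], which lies below no real [t]. *)
Lemma score_lt0 x t : 1 <= x -> score x t < 0.
Proof.
move=> x1; rewrite /score (bigD1 [ffun=> false]) //= ltr_wnDr //.
  rewrite -oppr_ge0 -sumrN; apply: sumr_ge0 => s _; rewrite oppr_ge0.
  rewrite pmulr_rle0 ?cw_weight_gt0 // pmulr_lle0 ?expR_gt0 //.
  have /andP[_ ?] := magnetization_itv s; lra.
rewrite pmulr_rlt0 ?cw_weight_gt0 // pmulr_llt0 ?expR_gt0 //.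
by rewrite magnetization_cst /=; lra.
Qed.

Lemma score_ge0 x t : x <= -1 -> 0 <= score x t.
Proof.
move=> x1; apply: sumr_ge0 => s _.
rewrite pmulr_rge0 ?cw_weight_gt0 // pmulr_lge0 ?expR_gt0 //.
have /andP[? _] := magnetization_itv s; lra.
Qed.

(** For an interior magnetization the estimate is a root of the strictly increasing [score], so its
    position relative to [t] is read off the sign of [score] at [t]. At magnetization 1 and -1 this
    sign is constant and matches the infinite values. *)
Lemma mle_h_le s t :
  (mle_h beta p s <= t%:E)%E = (mag s <= cw_expectation beta t p mag).
Proof.
rewrite cw_expectation_ge /mle_h; case: eqP => [->|/eqP m1].
  by apply/esym/negbTE; rewrite -ltNge score_lt0.
case: eqP => [->|/eqP m2]; first by rewrite score_ge0 // leNye.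
have xs : -1 < mag s < 1.
  have /andP[? ?] := magnetization_itv s.
  by rewrite !lt_neqAle m1 eq_sym m2 /=; apply/andP.
(* The default branch of [xget] is excluded by the existence of a root. *)
case: xgetP => [h _ /cw_expectation_eq sh|none]; last first.
  have [h sh] := score_root _ xs.
  by have := none h; case; apply/cw_expectation_eq.
rewrite lee_fin.
have /andP[_ x1] := xs.
have [ht|th] := leP h t; first by rewrite -sh score_le.
by apply/esym/negbTE; rewrite -ltNge -sh score_lt.
Qed.

Lemma scaled_mle_le s h t :
  ((Num.sqrt N%:R)%:E * (mle_h beta p s - h%:E) <= t%:E)%E =
  (mag s <= cw_expectation beta (h + t / Num.sqrt N%:R) p mag).
Proof.
have q0 : 0 < Num.sqrt N%:R :> R by rewrite sqrtr_gt0.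
rewrite -mle_h_le; case: (mle_h beta p s) => [r| |].
- rewrite -EFinB -EFinM !lee_fin mulrC -ler_pdivlMr // lerBlDl //.
- by rewrite addye // gt0_muley ?lte_fin // !leye_eq.
- by rewrite addNye // gt0_muleNy ?lte_fin // !leNye.
Qed.

End MLE.

(** * Counting configurations by their number of plus spins *)

Section Config.
Context {R : realType}.

Definition plus_spins N (s : config N) : {set 'I_N} := [set i | s i]%SET.

Lemma card_plus_spins N k :
  #|[pred s : config N | #|plus_spins N s| == k]| = 'C(N, k).
Proof.
rewrite -[in RHS](card_ord N) -card_draws -[RHS](card_imset _ (f := fun A : {set 'I_N} => [ffun i => i \in A] : config N)).
  apply: eq_card => s; rewrite inE; apply/idP/imsetP.
    move=> sk; exists (plus_spins N s); first by rewrite inE.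
    by apply/ffunP => i; rewrite ffunE inE.
  move=> [A]; rewrite inE => Ak ->; rewrite (_ : plus_spins N _ = A) //.
  by apply/setP => i; rewrite inE ffunE.
move=> A B /ffunP AB; apply/setP => i.
by have := AB i; rewrite !ffunE.
Qed.

Lemma magnetization_plus_spins N (s : config N) : (0 < N)%N ->
  magnetization R s = 2 * #|plus_spins N s|%:R / N%:R - 1.
Proof.
move=> N0; have N0' : N%:R != 0 :> R by rewrite pnatr_eq0 -lt0n.
have -> : #|plus_spins N s|%:R = \sum_(i < N) (s i)%:R :> R.
  rewrite -sum1_card natr_sum [RHS](bigID s) /= [X in _ + X]big1 ?addr0.
    apply: eq_big => i; first by rewrite inE.
    by rewrite inE => ->.
  by move=> i /negbTE ->.
rewrite /magnetization.
have -> : \sum_(i < N) spin R (s i) = 2 * (\sum_(i < N) (s i)%:R) - N%:R.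
  rewrite mulr_sumr -[in N%:R](card_ord N) -sumr_const -sumrB.
  by apply: eq_bigr => i _; rewrite /spin; case: (s i) => /=; lra.
by move: (\sum_(i < N) _) => S; field.
Qed.

Lemma sum_config N (F : R -> R) : (0 < N)%N ->
  \sum_(s : config N) F (magnetization R s) =
  \sum_(k < N.+1) 'C(N, k)%:R * F (2 * k%:R / N%:R - 1).
Proof.
move=> N0.
rewrite (partition_big (fun s : config N => inord #|plus_spins N s| : 'I_N.+1) xpredT) //=.
apply: eq_bigr => k _.
have eqk (s : config N) : (inord #|plus_spins N s| == k) = (#|plus_spins N s| == k).
  by rewrite -val_eqE /= inordK // ltnS -[leqRHS](card_ord N) max_card.
rewrite (eq_bigl _ _ eqk) -(card_plus_spins N k) -sum1_card natr_sum mulr_suml.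
apply: eq_big => [s|s sk]; first by [].
by rewrite mul1r magnetization_plus_spins // (eqP sk).
Qed.

End Config.

(** * Laplace's method *)

Section StepFunctions.
Context {R : realType}.
Local Notation mu := (@lebesgue_measure R : {measure set (measurableTypeR R) -> \bar R}).
Variables (v g : nat -> nat -> R).
Hypothesis vS : forall N k, v N k <= v N k.+1.

(** A Riemann sum on the mesh [v N] is the integral of this function, which brings it within reach
    of dominated convergence. *)
Definition step_fun N (x : R) : R :=
  \sum_(k < N.+1) g N k * \1_`[v N k, v N k.+1[ x.

Lemma mesh_le N j k : (j <= k)%N -> v N j <= v N k.
Proof.
elim: k => [|k IH]; first by rewrite leqn0 => /eqP ->.
rewrite leq_eqVlt => /orP[/eqP -> //|]; rewrite ltnS => /IH; move=> /le_trans; apply; exact: vS.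
Qed.

Lemma step_funE N k x : (k <= N)%N -> v N k <= x < v N k.+1 ->
  step_fun N x = g N k.
Proof.
move=> kN xk; rewrite /step_fun (bigD1 (inord k)) //= inordK ?ltnS //.
rewrite indicE mem_set ?mulr1; last by rewrite /= in_itv.
rewrite big1 ?addr0 // => i; rewrite -val_eqE /= inordK ?ltnS // => ik.
rewrite indicE memNset ?mulr0 //= in_itv /= => /andP[xi ix].
have /andP[kx xk'] := xk.
move: ik; rewrite neq_ltn => /orP[ik|ki].
  by have := lt_le_trans ix (mesh_le N _ _ ik); rewrite ltNge kx.
by have := lt_le_trans xk' (mesh_le N _ _ ki); rewrite ltNge xi.
Qed.

Lemma step_fun_out N x :
  (forall k, (k <= N)%N -> ~~ (v N k <= x < v N k.+1)) -> step_fun N x = 0.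
Proof.
move=> out; rewrite /step_fun big1 // => i _.
rewrite indicE memNset ?mulr0 //= in_itv /=.
by apply/negP/out; rewrite -ltnS.
Qed.

Lemma measurable_step_fun N : measurable_fun setT (step_fun N).
Proof.
rewrite /step_fun; apply: measurable_sum => k.
by apply: measurable_funM => //; exact: measurable_indic.
Qed.

Lemma integral_step_fun N : (\int[mu]_x (step_fun N x)%:E =
  (\sum_(k < N.+1) g N k * (v N k.+1 - v N k))%:E)%E.
Proof.
have int_ind k : mu.-integrable setT (EFin \o \1_`[v N k, v N k.+1[).
  exact: integrable_indic_itv.
under eq_integral do rewrite /step_fun -sumEFin.
rewrite integral_sum //=; last first.
  move=> k; under eq_fun do rewrite EFinM.
  exact: integrableZl (int_ind k).
rewrite -sumEFin; apply: eq_bigr => k _.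
under eq_integral do rewrite EFinM.
rewrite integralZl //; last exact: int_ind.
rewrite integral_indic // setIT; have /= -> := lebesgue_measure_itv `[v N k, v N k.+1[; rewrite lte_fin.
rewrite EFinM -EFinB; case: ltP => // h.
by congr (_ * _%:E)%E; apply/esym/eqP; rewrite subr_eq0 eq_le h vS.
Qed.

(** Dominated convergence for [step_fun]. The pointwise limit is expressed through the index [k N]
    of the cell that eventually contains [x], where the step function takes the value
    [g N (k N)]. *)
Lemma cvg_step_sum (G D : R -> R) :
  measurable_fun setT G -> mu.-integrable setT (EFin \o D) ->
  (forall x, 0 <= D x) ->
  (forall N k x, (k <= N)%N -> v N k <= x < v N k.+1 -> `|g N k| <= D x) ->
  {ae mu, forall x, exists k : nat -> nat,
    (\forall N \near \oo, (k N <= N)%N /\ v N (k N) <= x < v N (k N).+1) /\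
    g N (k N) @[N --> \oo] --> G x} ->
  mu.-integrable setT (EFin \o G) /\
  \sum_(k < N.+1) g N k * (v N k.+1 - v N k) @[N --> \oo] -->
    fine (\int[mu]_x (G x)%:E)%E.
Proof.
move=> mG iD D0 bnd lim.
have mF N : measurable_fun setT (EFin \o step_fun N).
  by apply/measurable_EFinP; exact: measurable_step_fun.
have mG' : measurable_fun setT (EFin \o G) by apply/measurable_EFinP.
have cvF : {ae mu, forall x, setT x ->
    (EFin \o step_fun N) x @[N --> \oo] --> (EFin \o G) x}.
  move: lim; apply: filterS; first exact: (ae_filter_ringOfSetsType mu).
  move=> x [k [kN gk]] _.
  apply: cvg_EFin; first exact: nearW.
  apply: cvg_trans gk; apply: near_eq_cvg.
  by apply: filterS kN => N [kN xk]; rewrite /= (step_funE _ _ _ kN xk).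
have bF : {ae mu, forall x N, setT x ->
    (`|(EFin \o step_fun N) x| <= (EFin \o D) x)%E}.
  apply: aeW => x N _; rewrite /= lee_fin.
  have [[k kN xk]|none] := pselect (exists2 k, (k <= N)%N & v N k <= x < v N k.+1).
    by rewrite (step_funE _ _ _ kN xk); exact: bnd kN xk.
  rewrite step_fun_out ?normr0 // => k kN; apply/negP => xk.
  by apply: none; exists k.
have [iG _ cv] := @dominated_convergence _ (measurableTypeR R) R mu setT measurableT
  (fun N => EFin \o step_fun N) (EFin \o G) (EFin \o D) mF mG' cvF iD bF.
split=> //; rewrite [X in X @ _ --> _](_ : _ =
    fine \o (fun N => \int[mu]_x (step_fun N x)%:E)%E); last first.
  by apply/funext => N /=; rewrite integral_step_fun.
by apply: fine_cvg; rewrite fineK //; exact: integrable_fin_num.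
Qed.

End StepFunctions.

(** * The rescaled binomial law and its domination *)

Section Laplace.
Context {R : realType}.
Variables (beta h : R) (p : nat) (m : R).
Local Notation mu := (@lebesgue_measure R : {measure set (measurableTypeR R) -> \bar R}).
Local Notation H := (Hfun beta h p).
Hypothesis m1 : -1 < m < 1.
Hypothesis mmax : forall x, x \in `[-1, 1] -> x != m -> H x < H m.
Hypothesis H2 : H^`(2)%classic m < 0.
Let a : R := - H^`(2)%classic m.
Let a0 : 0 < a. Proof. by rewrite oppr_gt0. Qed.
Let m_gt : 0 < 1 + m. Proof. by have /andP[? ?] := m1; lra. Qed.
Let m_lt : 0 < 1 - m. Proof. by have /andP[? ?] := m1; lra. Qed.

Definition mag_value N k : R := 2 * k%:R / N%:R - 1.

(** The value of [V] when [k] spins are plus. Scaling by [a] instead of its square root makes the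
    limit variance [a], and the tilt by [t V / a] then shifts the limit mean to [t]. *)
Definition dev N k : R := - H^`(2)%classic m * Num.sqrt N%:R * (mag_value N k - m).

Definition gap N : R := 2 * - H^`(2)%classic m / Num.sqrt N%:R.

(* The density of the law of the fluctuation on the mesh [dev N], up to the factor
   [2 ^ N * exp (N H(m))] and the normalizing constant. *)
Definition density N k : R :=
  binom_peak N k * expR (N%:R * (H (mag_value N k) - H m)) / gap N.

Let sqrtn_gt0 N : (0 < N)%N -> 0 < Num.sqrt N%:R :> R.
Proof. by rewrite sqrtr_gt0 ltr0n. Qed.

Lemma gap_gt0 N : (0 < N)%N -> 0 < gap N.
Proof. by move=> N0; rewrite divr_gt0 ?mulr_gt0 // sqrtn_gt0. Qed.

Lemma dev_gap N k : dev N k.+1 - dev N k = gap N.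
Proof.
rewrite /dev /gap /mag_value -/a; have [->|N0] := posnP N.
  by rewrite sqrtr0 invr0 !mulr0 !mul0r subrr.
have q0 := sqrtn_gt0 _ N0.
have -> : N%:R = Num.sqrt N%:R ^+ 2 :> R by rewrite sqr_sqrtr.
by rewrite sqrtr_sqr gtr0_norm // -natr1; field; rewrite gt_eqF.
Qed.

Lemma dev_mono N k : dev N k <= dev N k.+1.
Proof.
rewrite -subr_ge0 dev_gap /gap divr_ge0 ?sqrtr_ge0 //.
by rewrite mulr_ge0 // ltW.
Qed.

(** The exponent is [N (H x + entropy x)], and the entropy part combines with the binomial
    coefficient into [2 ^ N] times [binom_peak]. *)
Lemma cw_weight_density N k : (0 < N)%N -> (k <= N)%N ->
  'C(N, k)%:R * expR (N%:R * (beta * mag_value N k ^+ p + h * mag_value N k)) =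
  2 ^+ N * expR (N%:R * H m) * (density N k * gap N).
Proof.
move=> N0 kN; rewrite /density divfK; last by rewrite gt_eqF // gap_gt0.
have -> : N%:R * (beta * mag_value N k ^+ p + h * mag_value N k) =
   N%:R * H m + N%:R * (H (mag_value N k) - H m) + N%:R * entropy (mag_value N k).
  by rewrite /Hfun; ring.
rewrite expRD expRD expR_entropy_mag_value // /binom_peak.
by move: (expR _) (expR _) (_ ^+ k) (_ ^+ (N - k)) (2 ^+ N) => e1 e2 u v w; ring.
Qed.

Lemma sqrtn_cvg : (Num.sqrt N%:R)^-1 @[N --> \oo] --> (0 : R).
Proof.
apply/cvgr0Pnorm_le => e e0.
near=> N.
have N0 : (0 < N)%N by near: N; exact: nbhs_infty_gt.
have q0 := sqrtn_gt0 _ N0.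
rewrite ger0_norm ?invr_ge0 ?sqrtr_ge0 // -[leRHS]invrK lef_pV2 ?posrE ?invr_gt0 //.
rewrite -[e^-1]gtr0_norm ?invr_gt0 // -sqrtr_sqr ler_sqrt ?ler0n //.
by near: N; exact: nbhs_infty_ger.
Unshelve. all: end_near. Qed.

Lemma gap_cvg : gap N @[N --> \oo] --> (0 : R).
Proof.
rewrite -[X in _ --> X](mulr0 (2 * a)); apply: cvgM; first exact: cvg_cst.
exact: sqrtn_cvg.
Qed.

Lemma mag_value_dev N k : (0 < N)%N -> mag_value N k - m = dev N k / a * (Num.sqrt N%:R)^-1.
Proof.
move=> N0; rewrite /dev -/a; have q0 := sqrtn_gt0 _ N0.
by field; rewrite !gt_eqF.
Qed.

Lemma sqr_mag_value_dev N k : N%:R * (mag_value N k - m) ^+ 2 = (dev N k / a) ^+ 2.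
Proof.
have -> : dev N k / a = Num.sqrt N%:R * (mag_value N k - m).
  by rewrite /dev -/a; field; rewrite gt_eqF.
by rewrite exprMn sqr_sqrtr.
Qed.

(** * Limits along mesh points that converge *)

Section along.
Variables (k : nat -> nat) (y : R).
Hypothesis kN : \forall N \near \oo, (k N <= N)%N.
Hypothesis dev_cvg : dev N (k N) @[N --> \oo] --> y.

Lemma mag_value_cvg : mag_value N (k N) @[N --> \oo] --> m.
Proof.
have : dev N (k N) / a * (Num.sqrt N%:R)^-1 + m @[N --> \oo] --> m.
  rewrite -[X in _ --> X]add0r -[X in _ --> X + _](mulr0 (y / a)).
  apply: cvgD; last exact: cvg_cst.
  by apply: cvgM sqrtn_cvg; apply: cvgM => //; exact: cvg_cst.
apply: cvg_trans; apply: near_eq_cvg.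
near=> N; rewrite -mag_value_dev ?subrK //.
by near: N; exact: nbhs_infty_gt.
Unshelve. all: end_near. Qed.

Lemma ratio_cvg : (k N)%:R / N%:R @[N --> \oo] --> (1 + m) / 2.
Proof.
have -> : (fun N => (k N)%:R / N%:R) = (fun N => (1 + mag_value N (k N)) / 2).
  by apply/funext => N; rewrite /mag_value; lra.
apply: cvgM; last exact: cvg_cst.
by apply: cvgD; [exact: cvg_cst | exact: mag_value_cvg].
Qed.

Lemma ratio_cvgC : (N - k N)%:R / N%:R @[N --> \oo] --> (1 - m) / 2.
Proof.
have : 1 - (k N)%:R / N%:R @[N --> \oo] --> (1 - m) / 2.
  rewrite (_ : (1 - m) / 2 = 1 - (1 + m) / 2); last by lra.
  by apply: cvgB; [exact: cvg_cst | exact: ratio_cvg].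
apply: cvg_trans; apply: near_eq_cvg.
near=> N.
have N0 : (0 < N)%N by near: N; exact: nbhs_infty_gt.
have kN' : (k N <= N)%N by near: N.
by rewrite natrB // mulrBl divff // gt_eqF // ltr0n.
Unshelve. all: end_near. Qed.

Lemma cvg_infty_ratio (j : nat -> nat) (l : R) : 0 < l ->
  (j N)%:R / N%:R @[N --> \oo] --> l -> j N @[N --> \oo] --> \oo.
Proof.
move=> l0 jl; apply/cvgnyPge => A.
near=> N.
have N0 : (0 < N)%N by near: N; exact: nbhs_infty_gt.
have N0' : 0 < N%:R :> R by rewrite ltr0n.
have : l / 2 < (j N)%:R / N%:R.
  by near: N; apply: (cvgr_gt _ jl); lra.
rewrite ltr_pdivlMr // => h1.
have h2 : A%:R / (l / 2) <= N%:R by near: N; exact: nbhs_infty_ger.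
rewrite -(ler_nat R); apply/ltW/(le_lt_trans _ h1).
by rewrite mulrC -ler_pdivrMr // divr_gt0.
Unshelve. all: end_near. Qed.

(** The second-order expansion at [m] gives [- a N (x - m)^2 / 2], which is [- dev^2 / (2 a)]. *)
Lemma exponent_cvg :
  N%:R * (H (mag_value N (k N)) - H m) @[N --> \oo] --> - y ^+ 2 / (2 * a).
Proof.
have dev2 : dev N (k N) ^+ 2 @[N --> \oo] --> y ^+ 2.
  by rewrite !expr2; apply: cvgM.
have rem : N%:R * (H (mag_value N (k N)) - H m) + dev N (k N) ^+ 2 / (2 * a) @[N --> \oo] --> 0.
  apply/cvgr0Pnorm_le => e e0.
  have y20 : 0 < y ^+ 2 + 1 by rewrite ltr_wpDl // sqr_ge0.
  (* The Taylor error becomes [e' dev^2 / a^2] after multiplication by [N]. This choice of [e']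
     keeps it below [e] once [dev^2 < y^2 + 1]. *)
  have e'0 : 0 < e * a ^+ 2 / (y ^+ 2 + 1) by rewrite divr_gt0 ?mulr_gt0 ?exprn_gt0.
  have T := mag_value_cvg _ (Hfun_taylor _ _ _ _ m1 mmax _ e'0).
  near=> N.
  have : `|H (mag_value N (k N)) - H m - H^`(2)%classic m / 2 * (mag_value N (k N) - m) ^+ 2|
     <= e * a ^+ 2 / (y ^+ 2 + 1) * (mag_value N (k N) - m) ^+ 2 by near: N.
  have dlt : dev N (k N) ^+ 2 < y ^+ 2 + 1.
    by near: N; apply: (cvgr_lt _ dev2); rewrite ltrDl.
  move=> hT.
  have -> : N%:R * (H (mag_value N (k N)) - H m) + dev N (k N) ^+ 2 / (2 * a) =
    N%:R * (H (mag_value N (k N)) - H m -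
      H^`(2)%classic m / 2 * (mag_value N (k N) - m) ^+ 2).
    rewrite [RHS]mulrBr [N%:R * (_ / 2 * _)]mulrCA sqr_mag_value_dev.
    have -> : H^`(2)%classic m = - a by rewrite opprK.
    by congr (_ + _); field; rewrite !gt_eqF.
  rewrite normrM ger0_norm //; apply: le_trans (ler_wpM2l (ler0n _ N) hT) _.
  rewrite mulrCA sqr_mag_value_dev.
  have -> : e * a ^+ 2 / (y ^+ 2 + 1) * (dev N (k N) / a) ^+ 2 =
      e * (dev N (k N) ^+ 2 / (y ^+ 2 + 1)).
    by field; rewrite !gt_eqF.
  by rewrite ler_piMr ?(ltW e0) // ler_pdivrMr // mul1r ltW.
rewrite -[X in _ --> X]add0r.
have -> : (fun N => N%:R * (H (mag_value N (k N)) - H m)) =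
  (fun N => (N%:R * (H (mag_value N (k N)) - H m) + dev N (k N) ^+ 2 / (2 * a)) +
     - dev N (k N) ^+ 2 / (2 * a)).
  by apply/funext => N; lra.
apply: cvgD => //; apply: cvgM; last exact: cvg_cst.
exact: cvgN.
Unshelve. all: end_near. Qed.

(** Both spin counts tend to infinity, so the three Stirling remainders contribute
    [c - c - c = - c]. The factor [sqrt N] of [binom_peak] cancels the one in [gap]. *)
Lemma density_cvg (c : R) : stirling_rem n @[n --> \oo] --> c ->
  density N (k N) @[N --> \oo] -->
  (2 * a)^-1 * (expR (- c) / Num.sqrt ((1 + m) / 2 * ((1 - m) / 2))) *
    expR (- y ^+ 2 / (2 * a)).
Proof.
move=> cc.
have k_oo := cvg_infty_ratio _ _ (divr_gt0 m_gt (ltr0n _ 2)) ratio_cvg.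
have k_oo' := cvg_infty_ratio _ _ (divr_gt0 m_lt (ltr0n _ 2)) ratio_cvgC.
have : (2 * a)^-1 * (expR (stirling_rem N - stirling_rem (k N) - stirling_rem (N - k N))
   / Num.sqrt ((k N)%:R / N%:R * ((N - k N)%:R / N%:R)))
   * expR (N%:R * (H (mag_value N (k N)) - H m)) @[N --> \oo] -->
  (2 * a)^-1 * (expR (- c) / Num.sqrt ((1 + m) / 2 * ((1 - m) / 2))) *
    expR (- y ^+ 2 / (2 * a)).
  apply: cvgM; last first.
    by apply: (cvg_comp _ expR exponent_cvg); exact: continuous_expR.
  apply: cvgM; first exact: cvg_cst.
  apply: cvgM.
    apply: (cvg_comp _ expR); last exact: continuous_expR.
    rewrite (_ : - c = c - c - c); last by rewrite subrr sub0r.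
    apply: cvgB; last exact: (cvg_comp (fun N => N - k N)%N _ k_oo' cc).
    by apply: cvgB => //; exact: (cvg_comp k _ k_oo cc).
  apply: cvgV; first by rewrite gt_eqF // sqrtr_gt0 mulr_gt0 ?divr_gt0.
  apply: (cvg_comp _ Num.sqrt); last exact: sqrt_continuous.
  by apply: cvgM; [exact: ratio_cvg | exact: ratio_cvgC].
apply: cvg_trans; apply: near_eq_cvg; near=> N.
have N0 : (0 < N)%N by near: N; exact: nbhs_infty_gt.
have k0 : (0 < k N)%N by near: N; exact: (k_oo _ (nbhs_infty_gt 0)).
have k1 : (0 < N - k N)%N by near: N; exact: (k_oo' _ (nbhs_infty_gt 0)).
have q0 := sqrtn_gt0 _ N0.
have k2 : (0 < k N < N)%N by rewrite k0 -subn_gt0.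
rewrite /density binom_peak_stirling // /gap -/a.
have r0 : 0 < Num.sqrt ((k N)%:R / N%:R * ((N - k N)%:R / N%:R)) :> R.
  by rewrite sqrtr_gt0 mulr_gt0 ?divr_gt0 ?ltr0n.
move: (expR _) (expR _) (Num.sqrt (_ / _ * _)) r0 => u v w w0.
by field; rewrite !gt_eqF.
Unshelve. all: end_near. Qed.

End along.

Lemma expR_ge_id (x : R) : x <= expR x.
Proof. by apply: le_trans (expR_ge1Dx x); lra. Qed.

(** Stirling's formula bounds the prefactor [binom_peak / gap] while [x] stays near [m]. Farther
    away only [binom_peak <= 1] is used, leaving a factor of order [sqrt N]; there [|dev|] is itself
    at least of order [sqrt N], so [exp |dev|] absorbs that factor. *)
Lemma density_le : exists C c : R, [/\ 0 < C, 0 < c & forall N k, (0 < N)%N ->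
  (k <= N)%N -> density N k <= C * expR (`|dev N k| - c * dev N k ^+ 2)].
Proof.
have [c0 c00 Hc] := Hfun_quadratic_bound beta h p m m1 mmax H2.
(* Within distance [d] of [m] both [k / N] and [(N - k) / N] are at least [d / 2], so [e] bounds the
   square root in [binom_peak_stirling] from below. *)
pose d : R := Num.min (1 + m) (1 - m) / 2.
have d0 : 0 < d by rewrite divr_gt0 // lt_min m_gt m_lt.
have d1 : d <= (1 + m) / 2 by rewrite ler_pM2r // ge_min lexx.
have d2 : d <= (1 - m) / 2 by rewrite ler_pM2r // ge_min lexx orbT.
pose e : R := Num.sqrt (d / 2 * (d / 2)).
have e0 : 0 < e by rewrite sqrtr_gt0 mulr_gt0 // divr_gt0.
pose C : R := (2 * a)^-1 * (expR 1 / e + (a * d)^-1).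
have C1 : 0 < expR 1 / e by rewrite divr_gt0 ?expR_gt0.
have C2 : 0 < (a * d)^-1 by rewrite invr_gt0 mulr_gt0.
have ia0 : 0 < (2 * a)^-1 by rewrite invr_gt0 mulr_gt0.
exists C, (c0 / a ^+ 2); split.
- by rewrite mulr_gt0 // addr_gt0.
- by rewrite divr_gt0 // exprn_gt0.
move=> N k N0 kN.
have N0' : 0 < N%:R :> R by rewrite ltr0n.
have q0 := sqrtn_gt0 _ N0.
have x1 : -1 <= mag_value N k <= 1.
  have : 0 <= k%:R / N%:R :> R by rewrite divr_ge0.
  have : k%:R / N%:R <= 1 :> R by rewrite ler_pdivrMr // mul1r ler_nat.
  rewrite /mag_value -mulrA; move: (_ / _) => z z0 z1; apply/andP; split; lra.
have expo : expR (N%:R * (H (mag_value N k) - H m)) <= expR (- (c0 / a ^+ 2 * dev N k ^+ 2)).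
  rewrite ler_expR; apply: le_trans (ler_wpM2l (ler0n _ N) (Hc _ x1)) _.
  rewrite mulrCA sqr_mag_value_dev le_eqVlt; apply/orP; left; apply/eqP.
  by field; rewrite gt_eqF.
suff pre : binom_peak N k / gap N <= C * expR `|dev N k|.
  rewrite /density mulrAC expRD mulrA ler_pM ?expR_ge0 //.
  by rewrite divr_ge0 ?binom_peak_ge0 // ltW // gap_gt0.
have gapE (z : R) : z / gap N = (2 * a)^-1 * (z * Num.sqrt N%:R).
  by rewrite /gap -/a; field; rewrite !gt_eqF.
rewrite gapE /C -[leRHS]mulrA ler_pM2l //.
have E1 : 1 <= expR `|dev N k| by apply: le_trans (expR_ge1Dx _); rewrite lerDl.
have [near|far] := leP `|mag_value N k - m| d.
  move: near; rewrite ler_norml => /andP[n1 n2].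
  have rk : d / 2 <= k%:R / N%:R.
    by move: n1; rewrite /mag_value -mulrA; move: (k%:R / _) => z; lra.
  have rk' : d / 2 <= (N - k)%:R / N%:R.
    rewrite natrB // mulrBl divff ?gt_eqF //.
    by move: n2; rewrite /mag_value -mulrA; move: (k%:R / _) => z; lra.
  have k0 : (0 < k)%N.
    rewrite lt0n; apply/negP => /eqP k0; move: rk; rewrite k0 mul0r; lra.
  have k1 : (0 < N - k)%N.
    rewrite lt0n; apply/negP => /eqP k1; move: rk'; rewrite k1 mul0r; lra.
  have k2 : (0 < k < N)%N by rewrite k0 -subn_gt0.
  rewrite binom_peak_stirling //.
  have r0 : 0 < Num.sqrt (k%:R / N%:R * ((N - k)%:R / N%:R)) :> R.
    by rewrite sqrtr_gt0 mulr_gt0 ?divr_gt0 ?ltr0n.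
  have re : e <= Num.sqrt (k%:R / N%:R * ((N - k)%:R / N%:R)).
    by rewrite ler_wsqrtr // ler_pM // divr_ge0 // ltW.
  have st : expR (stirling_rem N - stirling_rem k - stirling_rem (N - k)) <= expR 1 :> R.
    rewrite ler_expR; have := @stirling_rem_le1 R _ N0.
    have := @stirling_rem_ge R _ k0; have := @stirling_rem_ge R _ k1; lra.
  rewrite (_ : _ / _ * _ = expR (stirling_rem N - stirling_rem k - stirling_rem (N - k)) /
     Num.sqrt (k%:R / N%:R * ((N - k)%:R / N%:R))); last first.
    by move: (expR _) (Num.sqrt (_ / _ * _)) r0 => u w w0; field; rewrite !gt_eqF.
  apply: (@le_trans _ _ (expR 1 / e)).
    by rewrite ler_pM ?expR_ge0 ?invr_ge0 ?sqrtr_ge0 // lef_pV2 ?posrE.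
  apply: (@le_trans _ _ (expR 1 / e + (a * d)^-1)); first by rewrite lerDl ltW.
  by rewrite ler_peMr // ltW // addr_gt0.
apply: (@le_trans _ _ (Num.sqrt N%:R)).
  by rewrite ler_piMl ?sqrtr_ge0 // binom_peak_le1.
apply: (@le_trans _ _ ((a * d)^-1 * expR `|dev N k|)); last first.
  by rewrite ler_wpM2r ?expR_ge0 // lerDr ltW.
rewrite ler_pdivlMl; last exact: mulr_gt0.
apply: (le_trans _ (expR_ge_id _)).
rewrite /dev -/a !normrM (gtr0_norm a0) (gtr0_norm q0).
by rewrite mulrAC ler_pM2l ?ltW // mulr_gt0.
Qed.

End Laplace.

(** * Gaussian integrals and the limit of the weighted sums *)

Section GaussianLimit.
Context {R : realType}.
Local Notation mu := (@lebesgue_measure R : {measure set (measurableTypeR R) -> \bar R}).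
Implicit Types (x y s : R).

(** The dominating function is evaluated at [x] in a cell and the density at its left end [y]. Half
    of [c y^2] absorbs [b |y|] by completing a square; the other half yields [c x^2 / 4] through
    [x^2 / 2 <= w^2 + y^2], whence the variance [2 / c]. *)
Lemma gauss_dominated (b c w : R) : 0 < c -> exists C tau : R, [/\ 0 <= C, tau != 0 &
  forall x y, `|x - y| <= w ->
    expR (b * `|y| - c * y ^+ 2) <= C * normal_pdf 0 tau x].
Proof.
move=> c0; pose tau : R := Num.sqrt (2 / c).
have tau0 : tau != 0 by rewrite gt_eqF // sqrtr_gt0 divr_gt0.
have tau2 : tau ^+ 2 = 2 / c by rewrite sqr_sqrtr // divr_ge0 // ltW.
have peak0 := normal_peak_gt0 tau0.
exists (expR (b ^+ 2 / (2 * c) + c / 2 * w ^+ 2) / normal_peak tau), tau; split => //.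
  by rewrite divr_ge0 ?expR_ge0 // ltW.
move=> x y xy; rewrite normal_pdfE //= [leRHS]mulrA divfK ?gt_eqF // /normal_fun -expRD.
rewrite ler_expR subr0 tau2.
have -> : - x ^+ 2 / ((2 / c) *+ 2) = - (c / 4 * x ^+ 2).
  by rewrite -mulr_natr; field; rewrite gt_eqF.
have sq : `|y| ^+ 2 = y ^+ 2 by rewrite real_normK ?num_real.
have h1 : b * `|y| <= b ^+ 2 / (2 * c) + c / 2 * y ^+ 2.
  rewrite -sq; have : 0 <= (b - c * `|y|) ^+ 2 / (2 * c).
    by rewrite divr_ge0 ?sqr_ge0 // mulr_ge0 // ltW.
  have -> : (b - c * `|y|) ^+ 2 / (2 * c) =
     b ^+ 2 / (2 * c) + c / 2 * `|y| ^+ 2 - b * `|y|.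
    by field; rewrite gt_eqF.
  by rewrite subr_ge0.
have h2 : x ^+ 2 / 2 <= w ^+ 2 + y ^+ 2.
  have w0 : 0 <= w by apply: le_trans xy.
  have : (x - y) ^+ 2 <= w ^+ 2.
    by rewrite -[in leLHS]real_normK ?num_real // ler_sqr ?nnegrE.
  have := sqr_ge0 (x - 2 * y).
  by rewrite !sqrrB; move: (w ^+ 2) => W; lra.
have := ler_wpM2l (ltW c0) h2.
move: h1; move: (b * _) (b ^+ 2 / _) (y ^+ 2) (x ^+ 2) (w ^+ 2) => A B Y X W.
lra.
Qed.

Lemma normal_pdf_tilt (sigma s x : R) : sigma != 0 ->
  normal_pdf 0 sigma x * expR (s * x) =
  expR (sigma ^+ 2 * s ^+ 2 / 2) * normal_pdf (sigma ^+ 2 * s) sigma x.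
Proof.
move=> s0; rewrite !normal_pdfE //= /normal_fun -[LHS]mulrA [RHS]mulrCA -!expRD.
congr (_ * expR _); rewrite subr0 -mulr_natr.
by field.
Qed.

Lemma integral_normal_pdf_expR (sigma s : R) : sigma != 0 ->
  (\int[mu]_x (normal_pdf 0 sigma x * expR (s * x))%:E =
   (expR (sigma ^+ 2 * s ^+ 2 / 2))%:E)%E.
Proof.
move=> s0; under eq_integral do rewrite normal_pdf_tilt // EFinM.
rewrite integralZl //; last exact: integrable_normal_pdf.
by rewrite integral_normal_pdf mule1.
Qed.

Variables (beta h : R) (p : nat) (m : R).
Local Notation H := (Hfun beta h p).
Hypothesis m1 : -1 < m < 1.
Hypothesis mmax : forall x, x \in `[-1, 1] -> x != m -> H x < H m.
Hypothesis H2 : H^`(2)%classic m < 0.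
Let a : R := - H^`(2)%classic m.
Let a0 : 0 < a. Proof. by rewrite oppr_gt0. Qed.
Let sd : R := Num.sqrt a.
Let sd0 : sd != 0. Proof. by rewrite gt_eqF // sqrtr_gt0. Qed.
Let sd2 : sd ^+ 2 = a. Proof. by rewrite sqr_sqrtr // ltW. Qed.
Local Notation devN := (dev beta h p m).
Local Notation gapN := (gap beta h p m).
Local Notation densityN := (density beta h p m).

Lemma density_dominated (b : R) : exists2 D : R -> R,
  mu.-integrable setT (EFin \o D) /\ (forall x, 0 <= D x) &
  forall N k x, (k <= N)%N -> devN N k <= x < devN N k.+1 ->
    densityN N k * expR (b * `|devN N k|) <= D x.
Proof.
have [C [c [C0 c0 le]]] := density_le beta h p m m1 mmax H2.
have [C' [tau [C'0 tau0 gd]]] := gauss_dominated (1 + b) c (2 * a) c0.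
exists (fun x => C * (C' * normal_pdf 0 tau x)).
  split; last by move=> x; rewrite !mulr_ge0 ?normal_pdf_ge0 // ltW.
  under [X in mu.-integrable _ X]eq_fun do rewrite /= !EFinM.
  by do 2 apply: integrableZl => //; exact: integrable_normal_pdf.
move=> N k x kN /andP[x1 x2].
(* For [N = 0] the mesh width is [0], since [0^-1 = 0], and no point lies in a cell. *)
have N0 : (0 < N)%N.
  rewrite lt0n; apply/negP => /eqP N0; have := le_lt_trans x1 x2.
  by rewrite -subr_gt0 dev_gap /gap N0 sqrtr0 invr0 mulr0 ltxx.
have xd : `|x - devN N k| <= 2 * a.
  rewrite ger0_norm ?subr_ge0 //.
  have := dev_gap beta h p m N k.
  have : gapN N <= 2 * a.
    rewrite /gap -/a ler_piMr ?mulr_ge0 ?(ltW a0) // invf_le1 ?sqrtr_gt0 ?ltr0n //.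
    by rewrite -[leLHS]sqrtr1 ler_sqrt ?ler0n // ler1n.
  by lra.
apply: (@le_trans _ _ (C * expR (`|devN N k| - c * devN N k ^+ 2) * expR (b * `|devN N k|))).
  by rewrite ler_wpM2r ?expR_ge0 // le.
rewrite -mulrA ler_pM2l // -expRD; apply: le_trans (gd _ _ xd).
by rewrite ler_expR mulrDl mul1r addrAC.
Qed.

Lemma dev_locate x : exists k : nat -> nat,
  [/\ \forall N \near \oo, (k N <= N)%N,
      \forall N \near \oo, devN N (k N) <= x < devN N (k N).+1
    & devN N (k N) @[N --> \oo] --> x].
Proof.
(* The real index at which the affine function [dev N] takes the value [x]. Its truncation is the
   cell of [x], and it lies between 0 and [N] eventually because [-1 < m < 1]. *)
pose z N : R := N%:R / 2 * (1 + m + x / a * (Num.sqrt N%:R)^-1).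
have /andP[m_gt m_lt] := m1.
have xs : x / a * (Num.sqrt N%:R)^-1 @[N --> \oo] --> (0 : R).
  by rewrite -[X in _ --> X](mulr0 (x / a)); apply: cvgM; [exact: cvg_cst | exact: sqrtn_cvg].
have z0 : \forall N \near \oo, 0 <= z N.
  near=> N; rewrite /z mulr_ge0 ?divr_ge0 //.
  have : - (1 + m) < x / a * (Num.sqrt N%:R)^-1.
    by near: N; apply: (cvgr_gt _ xs); lra.
  lra.
exists (fun N => Num.truncn (z N)).
have loc : \forall N \near \oo, devN N (Num.truncn (z N)) <= x < devN N (Num.truncn (z N)).+1.
  near=> N.
  have N0 : (0 < N)%N by near: N; exact: nbhs_infty_gt.
  have N0' : 0 < N%:R :> R by rewrite ltr0n.
  have q0 : 0 < Num.sqrt N%:R :> R by rewrite sqrtr_gt0.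
  have zN : 0 <= z N by near: N.
  have devE (j : nat) : x - devN N j = 2 * a / Num.sqrt N%:R * (z N - j%:R).
    rewrite /z /dev /mag_value -/a.
    have -> : N%:R = Num.sqrt N%:R ^+ 2 :> R by rewrite sqr_sqrtr.
    by rewrite sqrtr_sqr gtr0_norm //; field; rewrite !gt_eqF.
  have g0 : 0 < 2 * a / Num.sqrt N%:R by rewrite divr_gt0 // mulr_gt0.
  have /andP[t1 t2] := truncn_itv zN.
  rewrite -subr_ge0 -[_ < devN _ _]subr_lt0 !devE pmulr_rge0 // pmulr_rlt0 //.
  by rewrite subr_ge0 subr_lt0 t1.
split=> //.
- near=> N.
  have N0 : (0 < N)%N by near: N; exact: nbhs_infty_gt.
  have N0' : 0 < N%:R :> R by rewrite ltr0n.
  have zN : 0 <= z N by near: N.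
  rewrite -ltnS truncn_lt_nat // -natr1.
  have : x / a * (Num.sqrt N%:R)^-1 < 1 - m.
    by near: N; apply: (cvgr_lt _ xs); lra.
  move=> xm; have : z N <= N%:R / 2 * 2 by rewrite /z ler_pM2l ?divr_gt0 //; lra.
  lra.
- apply: (@squeeze_cvgr _ _ _ _ (fun N => x - gapN N) (fun=> x)).
  + near=> N.
    have /andP[l1 l2] : devN N (Num.truncn (z N)) <= x < devN N (Num.truncn (z N)).+1 by near: N.
    rewrite l1 andbT; have := dev_gap beta h p m N (Num.truncn (z N)); lra.
  + rewrite -[X in _ --> X]subr0; apply: cvgB; first exact: cvg_cst.
    exact: gap_cvg.
  + exact: cvg_cst.
Unshelve. all: end_near. Qed.

(** The constant [K], which contains the unknown Stirling constant, is chosen before the test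
    functions, so it cancels in quotients. Test functions may vary with [N], to allow a moving
    threshold; hence their limit is required along every sequence converging to [x]. *)
Lemma laplace_cvg : exists2 K : R, 0 < K &
  forall (b : R) (f : nat -> R -> R) (F : R -> R),
  (forall N y, `|f N y| <= expR (b * `|y|)) ->
  measurable_fun setT F ->
  {ae mu, forall x, forall y : nat -> R, y N @[N --> \oo] --> x ->
    f N (y N) @[N --> \oo] --> F x} ->
  \sum_(k < N.+1) (densityN N k * gapN N) * f N (devN N k) @[N --> \oo] -->
    K * fine (\int[mu]_x (normal_pdf 0 sd x * F x)%:E)%E.
Proof.
have [c cc] := @stirling_rem_cvg R.
pose K0 := (2 * a)^-1 * (expR (- c) / Num.sqrt ((1 + m) / 2 * ((1 - m) / 2))).
have /andP[m_gt m_lt] := m1.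
have K00 : 0 < K0.
  apply: mulr_gt0; first by rewrite invr_gt0 mulr_gt0.
  apply: divr_gt0; first exact: expR_gt0.
  by rewrite sqrtr_gt0 mulr_gt0 // divr_gt0 //; lra.
have peak0 := normal_peak_gt0 sd0.
pose K := K0 / normal_peak sd.
have K_gt0 : 0 < K by rewrite divr_gt0.
exists K => // b f F fb mF lim.
have [D [iD D0] bD] := density_dominated b.
pose g N k := densityN N k * f N (devN N k).
have mono N k : devN N k <= devN N k.+1 by exact: dev_mono.
pose phi x := normal_pdf 0 sd x * F x.
pose G x := K * phi x.
have mG : measurable_fun setT G.
  apply: measurable_funM => //; apply: measurable_funM => //.
  exact: measurable_normal_pdf.
have density0 N k : 0 <= densityN N k.
  apply: divr_ge0; first by rewrite mulr_ge0 ?binom_peak_ge0 ?expR_ge0.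
  by apply: divr_ge0; [rewrite mulr_ge0 // ltW | exact: sqrtr_ge0].
have bg N k x : (k <= N)%N -> devN N k <= x < devN N k.+1 -> `|g N k| <= D x.
  move=> kN xk; apply: le_trans (bD _ _ _ kN xk).
  by rewrite /g normrM ger0_norm // ler_wpM2l.
have lim' : {ae mu, forall x, exists k : nat -> nat,
    (\forall N \near \oo, (k N <= N)%N /\ devN N (k N) <= x < devN N (k N).+1) /\
    g N (k N) @[N --> \oo] --> G x}.
  move: lim; apply: filterS; first exact: (ae_filter_ringOfSetsType mu).
  move=> x fx; have [k [kN xk devx]] := dev_locate x.
  exists k; split; first exact: filterI.
  rewrite /g /G /phi -/a -/K0 /K normal_pdfE //= /normal_fun subr0 sd2 [K0 / _ * _]mulrA.
  rewrite (_ : K0 / normal_peak sd * (normal_peak sd * expR (- x ^+ 2 / (a *+ 2)))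
     = K0 * expR (- x ^+ 2 / (2 * a))).
    exact: (cvgM (density_cvg beta h p m m1 mmax H2 k x kN devx c cc)
      (fx (fun N => devN N (k N)) devx)).
  by rewrite -[a *+ 2]mulr_natl mulrA divfK // gt_eqF.
have [iG cv] := cvg_step_sum _ _ mono _ _ mG iD D0 bg lim'.
have iphi : mu.-integrable setT (EFin \o phi).
  have -> : EFin \o phi = (fun x => (K^-1)%:E * (EFin \o G) x)%E.
    by apply/funext => x; rewrite /= -EFinM /G mulKf // gt_eqF.
  exact: integrableZl.
have -> : K * fine (\int[mu]_x (phi x)%:E)%E = fine (\int[mu]_x (G x)%:E)%E.
  under [in RHS]eq_integral do rewrite /G EFinM.
  by rewrite integralZl // fineM //; exact: integrable_fin_num.
move: cv; apply: cvg_trans; apply: near_eq_cvg; apply: nearW => N.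
by apply: eq_bigr => k _; rewrite dev_gap /g mulrAC.
Qed.

End GaussianLimit.

(** * Limit laws *)

Section CurieWeiss.
Context {R : realType}.
Local Notation mu := (@lebesgue_measure R : {measure set (measurableTypeR R) -> \bar R}).
Variables (beta h : R) (p : nat) (m : R).
Local Notation H := (Hfun beta h p).
Hypothesis m1 : -1 < m < 1.
Hypothesis mmax : forall x, x \in `[-1, 1] -> x != m -> H x < H m.
Hypothesis H2 : H^`(2)%classic m < 0.
Let a : R := - H^`(2)%classic m.
Let a0 : 0 < a. Proof. by rewrite oppr_gt0. Qed.
Let sd : R := Num.sqrt a.
Let sd0 : sd != 0. Proof. by rewrite gt_eqF // sqrtr_gt0. Qed.
Let sd2 : sd ^+ 2 = a. Proof. by rewrite sqr_sqrtr // ltW. Qed.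

Definition fluctuation N (s : config N) : R :=
  - H^`(2)%classic m * Num.sqrt N%:R * (magnetization R s - m).

Lemma sum_cw_weight N (f : R -> R) : (0 < N)%N ->
  \sum_(s : config N) cw_weight beta h p s * f (fluctuation N s) =
  2 ^+ N * expR (N%:R * H m) *
  \sum_(k < N.+1) density beta h p m N k * gap beta h p m N * f (dev beta h p m N k).
Proof.
move=> N0; rewrite (sum_config N (fun x => expR (N%:R * (beta * x ^+ p + h * x)) *
   f (- H^`(2)%classic m * Num.sqrt N%:R * (x - m)))) // mulr_sumr.
apply: eq_bigr => k _.
by rewrite mulrA (cw_weight_density beta h p m H2) ?mulrA // -ltnS.
Qed.

(** Numerator and partition sum are both instances of [laplace_cvg], the latter with the constant
    test function 1, so [K] and the common prefactor cancel. *)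
Lemma cw_expectation_cvg (b : R) (f : nat -> R -> R) (F : R -> R) :
  (forall N y, `|f N y| <= expR (b * `|y|)) ->
  measurable_fun setT F ->
  {ae mu, forall x, forall y : nat -> R, y N @[N --> \oo] --> x ->
    f N (y N) @[N --> \oo] --> F x} ->
  cw_expectation beta h p (fun s => f N (fluctuation N s)) @[N --> \oo] -->
  fine (\int[mu]_x (normal_pdf 0 sd x * F x)%:E)%E.
Proof.
move=> fb mF lim.
have [K K0 KP] := laplace_cvg beta h p m m1 mmax H2.
have cf := KP b f F fb mF lim.
have c1 : \sum_(k < N.+1) (density beta h p m N k * gap beta h p m N) * 1 @[N --> \oo] --> K.
  have := KP 0 (fun _ _ => 1) (fun=> 1).
  rewrite (_ : (\int[mu]_x (normal_pdf 0 (Num.sqrt (- H^`(2)%classic m)) x * 1)%:E)%E = 1%E).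
    rewrite mulr1; apply.
    + by move=> *; rewrite normr1 mul0r expR0.
    + exact: measurable_cst.
    + by apply: aeW => x y _; exact: cvg_cst.
  under eq_integral do rewrite mulr1.
  exact: integral_normal_pdf.
rewrite -[X in _ --> X](mulKf (lt0r_neq0 K0)) mulrC.
apply: cvg_trans (cvgM cf (cvgV (lt0r_neq0 K0) c1)).
apply: near_eq_cvg; near=> N.
have N0 : (0 < N)%N by near: N; exact: nbhs_infty_gt.
rewrite /= cw_expectationE (sum_cw_weight N (f N)) //.
rewrite (_ : \sum_(s : config N) cw_weight beta h p s =
    \sum_(s : config N) cw_weight beta h p s * (fun=> 1) (fluctuation N s)); last first.
  by apply: eq_bigr => s _; rewrite mulr1.
rewrite (sum_cw_weight N (fun=> 1)) //.
by rewrite -mulf_div divff ?mul1r // mulf_neq0 // gt_eqF ?expR_gt0 // exprn_gt0.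
Unshelve. all: end_near. Qed.

Lemma laplace_transform_cvg (s : R) :
  cw_expectation beta h p (fun w => expR (s * fluctuation N w)) @[N --> \oo] -->
  expR (a * s ^+ 2 / 2).
Proof.
have := @cw_expectation_cvg `|s| (fun _ y => expR (s * y)) (fun y => expR (s * y)).
rewrite integral_normal_pdf_expR // sd2; apply.
- move=> N y; rewrite ger0_norm ?expR_ge0 // ler_expR -normrM; exact: ler_norm.
- by apply: measurableT_comp => //; exact: measurable_funM.
- apply: aeW => x y yx; apply: (cvg_comp _ expR); last exact: continuous_expR.
  by apply: cvgM => //; exact: cvg_cst.
Qed.

(** The extra exponent [t sqrt N * magnetization] is [t V / a] plus [t sqrt N m]; the last part does
    not depend on the configuration and disappears on normalizing. *)
Lemma tilted_weight N (t : R) (s : config N) : (0 < N)%N ->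
  cw_weight beta (h + t / Num.sqrt N%:R) p s =
  cw_weight beta h p s * expR (t / a * fluctuation N s) * expR (t * Num.sqrt N%:R * m).
Proof.
move=> N0; rewrite /cw_weight -!expRD; congr expR; rewrite /fluctuation -/a.
have q0 : 0 < Num.sqrt N%:R :> R by rewrite sqrtr_gt0 ltr0n.
have -> : N%:R = Num.sqrt N%:R ^+ 2 :> R by rewrite sqr_sqrtr.
by rewrite sqrtr_sqr gtr0_norm //; field; rewrite !gt_eqF.
Qed.

Definition tilted_mean (t : R) N : R :=
  cw_expectation beta (h + t / Num.sqrt N%:R) p (fluctuation N).

Lemma fluctuation_mean t N : (0 < N)%N ->
  tilted_mean t N = a * Num.sqrt N%:R *
    (cw_expectation beta (h + t / Num.sqrt N%:R) p (@magnetization R N) - m).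
Proof.
move=> N0; rewrite /tilted_mean !cw_expectationE.
have S0 := sum_cw_weight_gt0 beta p N (h + t / Num.sqrt N%:R).
rewrite -[in RHS](mulfK (lt0r_neq0 S0) m) -mulrBl mulrA; congr (_ / _).
rewrite mulr_sumr -sumrB mulr_sumr; apply: eq_bigr => s _.
by rewrite /fluctuation -/a; ring.
Qed.

(* From [1 + x <= exp x]; both signs of [e] are used. *)
Lemma tilted_mean_bound t N (e : R) : (0 < N)%N ->
  e * tilted_mean t N <=
  cw_expectation beta h p (fun w => expR ((t / a + e) * fluctuation N w)) /
  cw_expectation beta h p (fun w => expR (t / a * fluctuation N w)) - 1.
Proof.
move=> N0; rewrite /tilted_mean !cw_expectationE.
have S0 := sum_cw_weight_gt0 beta p N h.
pose wt (s : config N) := cw_weight beta h p s * expR (t / a * fluctuation N s).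
have wt0 s : 0 < wt s by rewrite mulr_gt0 ?cw_weight_gt0 ?expR_gt0.
have T0 : 0 < \sum_s wt s.
  rewrite (bigD1 [ffun=> true]) //= ltr_wpDr //.
  by apply: sumr_ge0 => s _; exact/ltW.
have E0 := expR_gt0 (t * Num.sqrt N%:R * m).
rewrite invf_div [X in _ <= X - 1]mulrA divfK ?gt_eqF //.
rewrite (eq_bigr (fun s => expR (t * Num.sqrt N%:R * m) * (wt s * fluctuation N s))); last first.
  by move=> s _; rewrite tilted_weight // /wt; ring.
rewrite [X in _ / X](eq_bigr (fun s => expR (t * Num.sqrt N%:R * m) * wt s)); last first.
  by move=> s _; rewrite tilted_weight // /wt; ring.
rewrite -!mulr_sumr -mulf_div divff ?gt_eqF // mul1r mulrA.
rewrite -[X in _ - X](divff (lt0r_neq0 T0)) -mulrBl ler_pM2r ?invr_gt0 //.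
rewrite mulr_sumr -sumrB; apply: ler_sum => s _.
rewrite -[X in _ - X]/(wt s) mulrDl expRD.
rewrite [leRHS](_ : _ = wt s * (expR (e * fluctuation N s) - 1)); last first.
  by rewrite /wt; ring.
rewrite mulrCA ler_pM2l //; have := expR_ge1Dx (e * fluctuation N s); lra.
Qed.

(** The ratio in [tilted_mean_bound] tends to [exp (t e + a e^2 / 2)], whose derivative at [e = 0]
    is [t]. A positive [e] bounds the mean from above and its opposite bounds it from below. *)
Lemma tilted_mean_cvg (t : R) : tilted_mean t N @[N --> \oo] --> t.
Proof.
pose M e N := cw_expectation beta h p (fun w => expR ((t / a + e) * fluctuation N w)) /
  cw_expectation beta h p (fun w => expR (t / a * fluctuation N w)) : R.
have Mc e : M e N @[N --> \oo] --> expR (t * e + a * e ^+ 2 / 2).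
  rewrite (_ : t * e + a * e ^+ 2 / 2 = a * (t / a + e) ^+ 2 / 2 - a * (t / a) ^+ 2 / 2).
    rewrite expRD expRN; apply: cvgM; first exact: laplace_transform_cvg.
    apply: cvgV; first by rewrite gt_eqF // expR_gt0.
    exact: laplace_transform_cvg.
  by field; rewrite gt_eqF.
have gd : is_derive (0 : R) 1 (fun e : R => expR (t * e + a * e ^+ 2 / 2)) t.
  have d : is_derive (0 : R) 1 (fun e : R => t * e + a * e ^+ 2 / 2) t.
    by apply: is_derive_eq; rewrite /GRing.scale /=; lra.
  apply: is_derive_eq (is_derive1_comp (is_derive_expR _) d) _.
  by rewrite expr0n /= !mulr0 mul0r addr0 expR0 mul1r.
apply/cvgrPdist_le => eps eps0.
have eps2 : 0 < eps / 2 by rewrite divr_gt0.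
have /nbhs_ballP[d /= d0 near0] := is_derive_near_le _ _ _ _ gd eps2.
(* This [e] is fixed before [N]: half of [eps] pays for the difference quotient at [e] and [- e],
   the other half for the convergence in [N]. *)
pose e := d / 2; have e0 : 0 < e by rewrite divr_gt0.
have bound (u : R) : `|u| = e ->
    expR (t * u + a * u ^+ 2 / 2) - 1 <= t * u + eps / 2 * e.
  move=> ue; have := near0 u; rewrite /ball /= sub0r normrN ue => /(_ _).
  have -> : e < d by rewrite /e; lra.
  move=> /(_ isT); rewrite !subr0 ue expr0n /= !mulr0 mul0r addr0 expR0 ler_norml.
  by move=> /andP[_]; move: (expR _) => E; lra.
have near_u (u : R) : `|u| = e -> \forall N \near \oo, u * tilted_mean t N <= t * u + eps * e.
  move=> ue; near=> N.
  have N0 : (0 < N)%N by near: N; exact: nbhs_infty_gt.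
  apply: le_trans (tilted_mean_bound t N u N0) _.
  have : M u N < expR (t * u + a * u ^+ 2 / 2) + eps / 2 * e.
    by near: N; apply: (cvgr_lt _ (Mc u)); rewrite ltrDl mulr_gt0.
  have := bound u ue; rewrite -/(M u N); lra.
have n1 := near_u e (gtr0_norm e0).
have n2 : \forall N \near \oo, - e * tilted_mean t N <= t * - e + eps * e.
  by apply: near_u; rewrite normrN gtr0_norm.
near=> N.
have h1 : e * tilted_mean t N <= t * e + eps * e by near: N.
have h2 : - e * tilted_mean t N <= t * - e + eps * e by near: N.
move: h1 h2; move: (tilted_mean t N) => x h1 h2.
rewrite ler_norml; apply/andP; split; rewrite -(ler_pM2l e0); lra.
Unshelve. all: end_near. Qed.

(** For [x != t] the midpoint of [x] and [t] eventually separates [y N] from [c N]; the remaining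
    point [t] is Lebesgue-null. *)
Lemma indic_le_cvg (c : nat -> R) (t : R) : c N @[N --> \oo] --> t ->
  {ae mu, forall x, forall y : nat -> R, y N @[N --> \oo] --> x ->
    ((y N <= c N)%R%:R : R) @[N --> \oo] --> ((x <= t)%R%:R : R)}.
Proof.
move=> ct.
have : mu.-negligible [set t].
  by apply/negligibleP => //; exact: lebesgue_measure_set1.
apply: negligibleS => x; rewrite /setC /= => nx; apply: contrapT => xt; apply: nx => y yx.
have [xlt|tlt|xt'] := ltgtP x t; last by case: xt.
- apply: cvg_near_cst; near=> N.
  have h1 : y N < (x + t) / 2 by near: N; apply: (cvgr_lt _ yx); lra.
  have h2 : (x + t) / 2 < c N by near: N; apply: (cvgr_gt _ ct); lra.
  by rewrite ltW // (lt_trans h1).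
- apply: cvg_near_cst; near=> N.
  have h1 : (x + t) / 2 < y N by near: N; apply: (cvgr_gt _ yx); lra.
  have h2 : c N < (x + t) / 2 by near: N; apply: (cvgr_lt _ ct); lra.
  by rewrite leNgt (lt_trans h2).
Unshelve. all: end_near. Qed.

Lemma mle_cvg (t : R) :
  \sum_(s : config N | ((Num.sqrt N%:R)%:E * (mle_h beta p s - h%:E) <= t%:E)%E)
     cw_mass beta h p s @[N --> \oo] -->
  fine (normal_prob 0 sd `]-oo, t]%classic).
Proof.
have := @cw_expectation_cvg 0 (fun N y => (y <= tilted_mean t N)%R%:R)
  (fun y => (y <= t)%R%:R).
have -> : (\int[mu]_x (normal_pdf 0 sd x * (x <= t)%R%:R)%:E)%E =
    normal_prob 0 sd `]-oo, t]%classic.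
  rewrite /normal_prob [RHS]integral_mkcond; apply: eq_integral => x _.
  rewrite patchE; case: ifPn; rewrite ?inE ?notin_setE /= in_itv /=.
    by move=> ->; rewrite mulr1.
  by move=> /negP/negbTE ->; rewrite mulr0.
have b1 N (y : R) : `|(y <= tilted_mean t N)%R%:R : R| <= expR (0 * `|y|).
  by rewrite mul0r expR0; case: (y <= _); rewrite ?normr1 ?normr0.
have mI : measurable_fun setT (fun y : R => (y <= t)%R%:R : R).
  rewrite (_ : (fun y : R => _) = \1_`]-oo, t]%classic); first exact: measurable_indic.
  apply/funext => y; rewrite indicE; congr ((nat_of_bool _)%:R).
  by apply/idP/idP; rewrite inE /= in_itv.
move=> /(_ b1 mI (indic_le_cvg _ _ (tilted_mean_cvg t))); apply: cvg_trans.
apply: near_eq_cvg; near=> N.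
have N0 : (0 < N)%N by near: N; exact: nbhs_infty_gt.
(* Magnetization and [V] are related by an increasing affine map, so the event of [scaled_mle_le] is
   that [V] is at most [tilted_mean t N]. *)
have q0 : 0 < a * Num.sqrt N%:R by rewrite mulr_gt0 // sqrtr_gt0 ltr0n.
rewrite /cw_expectation [RHS]big_mkcond; apply: eq_bigr => s _.
rewrite (scaled_mle_le beta p N N0) fluctuation_mean // /fluctuation -/a.
by rewrite ler_pM2l // lerD2r; case: (_ <= _); rewrite ?mulr1 ?mulr0.
Unshelve. all: end_near. Qed.

End CurieWeiss.

Theorem theorem2p1 (R : realType) (p : nat) (beta h m : R)
  (hp : (3 <= p)%N) (hbeta : 0 <= beta) (hreg : p_regular beta h p)
  (hm : global_maximizer beta h p m) :
  cvg_in_distribution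
    (fun N : nat => @cw_mass R beta h p N)
    (fun N (s : config N) =>
       ((Num.sqrt N%:R)%:E * (mle_h beta p s - h%:E))%E)
    (normal_prob 0 (Num.sqrt (- (Hfun beta h p)^`(2)%classic m))).
Proof.
have [m' [[hm' uniq] m1 H2]] := hreg.
have e := uniq _ hm; subst m'.
have m1' : -1 < m < 1 by rewrite in_itv in m1.
move=> t _; apply: mle_cvg => // x x1 xm.
(* A point other than [m] with the same value would be a second global maximizer, which uniqueness
   forbids; this gives the strict inequality. *)
have [_ mx] := hm; rewrite lt_neqAle mx // andbT; apply/negP => /eqP Hx.
move/eqP: xm; apply; apply/esym/uniq; split => // y y1.
by rewrite Hx; exact: mx.
Qed.
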